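(* For every integer $s\geq 1$, the complex $(Q^{\bullet},\partial^{\bullet})$ of right $\Lambda_s^e$-modules, augmented by $\partial^0:Q^0\to\Lambda_s$, is a minimal projective $\Lambda_s^e$-resolution of $\Lambda_s$ (i.e. a minimal projective resolution of $\Lambda_s$ as a $\Lambda_s$-$\Lambda_s$-bimodule).
   Context: $K$ is an algebraically closed field. For $s\geq 1$, $\Gamma_s$ is the circular quiver with double arrows: its vertices are $0,1,\dots,s-1$ (indices modulo $s$) and for each $i$ there are exactly two arrows $a_i,b_i$ from $i$ to $i+1$. Paths are composed from left to right, and $e_i$ is the trivial path at $i$. Put $x=\sum_{i=0}^{s-1}a_i$ and $y=\sum_{i=0}^{s-1}b_i$ in the path algebra $K\Gamma_s$, so $e_ix^n=x^ne_{i+n}$ and $e_iy^n=y^ne_{i+n}$. Let $I=\langle x^2,xy+yx,y^2\rangle$ (two-sided ideal) and $\Lambda_s=K\Gamma_s/I$. Let $\Lambda_s^e=\Lambda_s^{\mathrm{op}}\otimes_K\Lambda_s$; $\Lambda_s$-$\Lambda_s$-bimodules are identified with right $\Lambda_s^e$-modules. Write $\otimes=\otimes_K$. For $n\geq 0$ put $Q^n=\bigoplus_{i=0}^{s-1}\bigoplus_{j=0}^{n}\Lambda_s b_{i,j}^n\Lambda_s$, where $\Lambda_s b_{i,j}^n\Lambda_s$ is a copy of $\Lambda_s e_i\otimes e_{i+n}\Lambda_s$ with generator $b_{i,j}^n=e_i\otimes e_{i+n}$. The subscript $i$ of $b_{i,j}^n$ is taken modulo $s$. The map $\partial^0:Q^0\to\Lambda_s$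 is the multiplication map, and for $n\geq 1$, $\partial^n:Q^n\to Q^{n-1}$ is the bimodule homomorphism determined, for $0\leq i\leq s-1$, by $b_{i,0}^n\mapsto b_{i,0}^{n-1}y+(-1)^n y\,b_{i+1,0}^{n-1}$; $b_{i,j}^n\mapsto (b_{i,j-1}^{n-1}x+b_{i,j}^{n-1}y)+(-1)^n(y\,b_{i+1,j}^{n-1}+x\,b_{i+1,j-1}^{n-1})$ for $1\leq j\leq n-1$; $b_{i,n}^n\mapsto b_{i,n-1}^{n-1}x+(-1)^n x\,b_{i+1,n-1}^{n-1}$. *)

(* Defs.v *)
From HB Require Import structures.
From mathcomp Require Import all_boot all_algebra.
From mathcomp Require Import boolp.
From mathcomp Require Import finmap monalg.

Set Implicit Arguments.
Unset Strict Implicit.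
Unset Printing Implicit Defensive.

Import GRing.Theory.
Local Open Scope ring_scope.
Local Open Scope quotient_scope.

(* Conversion must not unfold the quotients and free modules built below. *)
Fact lock_key : unit. Proof. exact: tt. Qed.

Section SubmoduleGen.
Variables (R : pzRingType) (V : lmodType R).

Definition submod_gen (S : V -> Prop) : {pred V} :=
  fun z => `[< forall J : {pred V}, submod_closed J ->
               (forall x, S x -> x \in J) -> z \in J >].

Lemma submod_gen_closed S : submod_closed (submod_gen S).
Proof.
split=> [|a u v /asboolP Hu /asboolP Hv]; apply/asboolP => J HJ SJ.
  by case: HJ.
by case: (HJ) => _; apply; [apply: Hu | apply: Hv].
Qed.

HB.instance Definition _ S :=
  GRing.isSubmodClosed.Build R V (submod_gen S) (submod_gen_closed S).

Lemma mem_submod_gen (S : V -> Prop) x : S x -> x \in submod_gen S.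
Proof. by move=> Sx; apply/asboolP => J _; apply. Qed.

End SubmoduleGen.

Section LmodQuotient.
Variables (R : pzRingType) (V : lmodType R) (I : submodClosed V).

Definition submod_pred : {pred V} := I.

Lemma submod_pred_zmod : zmod_closed submod_pred.
Proof. exact: GRing.submod_closedB (submodClosedP I). Qed.
HB.instance Definition _ :=
  GRing.isZmodClosed.Build V submod_pred submod_pred_zmod.

Definition lquot := {ideal_quot submod_pred}.
HB.instance Definition _ := GRing.Zmodule.on lquot.

Definition to_lquot : V -> lquot :=
  locked_with lock_key (fun x => \pi_({ideal_quot submod_pred}) x).
Definition of_lquot : lquot -> V :=
  locked_with lock_key (fun q : {ideal_quot submod_pred} => repr q).

Lemma of_lquotK q : to_lquot (of_lquot q) = q.
Proof. by rewrite /to_lquot /of_lquot !locked_withE reprK. Qed.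

Lemma to_lquot_eq x y : (to_lquot x = to_lquot y) <-> (x - y \in I).
Proof.
rewrite -[_ \in I]/(x - y \in submod_pred) Quotient.idealrBE.
by rewrite /to_lquot !locked_withE; split => /eqP.
Qed.

Lemma to_lquotD x y : to_lquot (x + y) = to_lquot x + to_lquot y.
Proof. by rewrite /to_lquot !locked_withE raddfD. Qed.

Definition lquot_scale : R -> lquot -> lquot :=
  locked_with lock_key (fun a q => to_lquot (a *: of_lquot q)).

Lemma to_lquotZ a x : to_lquot (a *: x) = lquot_scale a (to_lquot x).
Proof.
rewrite /lquot_scale locked_withE.
apply/to_lquot_eq; rewrite -scalerBr rpredZ //.
by apply/to_lquot_eq; rewrite of_lquotK.
Qed.

Lemma lquot_scaleA a b q :
  lquot_scale a (lquot_scale b q) = lquot_scale (a * b) q.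
Proof. by rewrite -[q]of_lquotK -!to_lquotZ scalerA. Qed.
Lemma lquot_scale1 : left_id 1 lquot_scale.
Proof. by move=> q; rewrite -[q]of_lquotK -!to_lquotZ scale1r. Qed.
Lemma lquot_scaleDr : right_distributive lquot_scale +%R.
Proof.
move=> a q r; rewrite -[q]of_lquotK -[r]of_lquotK.
by rewrite -to_lquotD -!to_lquotZ -to_lquotD scalerDr.
Qed.
Lemma lquot_scaleDl q : {morph lquot_scale^~ q : a b / a + b}.
Proof.
by move=> a b; rewrite -[q]of_lquotK -!to_lquotZ -to_lquotD scalerDl.
Qed.
HB.instance Definition _ := GRing.Zmodule_isLmodule.Build R lquot
  lquot_scaleA lquot_scale1 lquot_scaleDr lquot_scaleDl.

Lemma to_lquot_is_linear : linear to_lquot.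
Proof. by move=> a x y; rewrite to_lquotD to_lquotZ. Qed.
HB.instance Definition _ :=
  GRing.isLinear.Build R V lquot _ to_lquot to_lquot_is_linear.

End LmodQuotient.

Section IdealGen.
Variable A : pzRingType.

Definition twosided_ideal (J : {pred A}) : Prop :=
  [/\ zmod_closed J, forall a x, x \in J -> a * x \in J
                   & forall a x, x \in J -> x * a \in J].

Definition ideal_gen (S : seq A) : {pred A} :=
  fun z => `[< forall J : {pred A}, twosided_ideal J ->
               {subset S <= J} -> z \in J >].

Lemma mem_ideal_gen S x : x \in S -> x \in ideal_gen S.
Proof. by move=> Sx; apply/asboolP => J _; apply. Qed.

Lemma ideal_gen_twosided S : twosided_ideal (ideal_gen S).
Proof.
split=> [|a x /asboolP Hx|a x /asboolP Hx].
- split=> [|u v /asboolP Hu /asboolP Hv]; apply/asboolP => J HJ SJ.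
    by case: HJ => -[].
  by case: (HJ) => -[_ H] _ _; apply: H; [apply: Hu | apply: Hv].
- apply/asboolP => J HJ SJ.
  by case: (HJ) => _ H _; apply: H; apply: Hx.
apply/asboolP => J HJ SJ.
by case: (HJ) => _ _ H; apply: H; apply: Hx.
Qed.

Lemma ideal_genMl S a x : x \in ideal_gen S -> a * x \in ideal_gen S.
Proof. by case: (ideal_gen_twosided S) => _ H _; apply: H. Qed.
Lemma ideal_genMr S a x : x \in ideal_gen S -> x * a \in ideal_gen S.
Proof. by case: (ideal_gen_twosided S) => _ _ H; apply: H. Qed.

End IdealGen.

Section FreeModule.
Variables (K : fieldType) (X : choiceType) (V : lmodType K).

Definition malg_lift : (X -> V) -> {malg K[X]} -> V :=
  locked_with lock_key (fun f g => \sum_(x <- msupp g) g@_x *: f x).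

Lemma malg_liftE f g : malg_lift f g = \sum_(x <- msupp g) g@_x *: f x.
Proof. by rewrite /malg_lift locked_withE. Qed.

Lemma malg_liftEw f (d : {fset X}) g : (msupp g `<=` d)%fset ->
  malg_lift f g = \sum_(x <- d) g@_x *: f x.
Proof.
move=> le; rewrite malg_liftE [LHS](big_fset_incl _ le) //= => x _ xNg.
by rewrite mcoeff_outdom // scale0r.
Qed.

Lemma malg_lift_is_linear f : linear (malg_lift f).
Proof.
move=> a g h; set d := (msupp g `|` msupp h)%fset.
have led : (msupp (a *: g + h) `<=` d)%fset.
  apply: fsubset_trans (msuppD_le _ _) _.
  exact: fsetUSS (msuppZ_le _ _) (fsubset_refl _).
rewrite (malg_liftEw f led) (malg_liftEw f (fsubsetUl _ _ : (msupp g `<=` d)%fset)).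
rewrite (malg_liftEw f (fsubsetUr _ _ : (msupp h `<=` d)%fset)) scaler_sumr -big_split /=.
by apply: eq_bigr => x _; rewrite mcoeffD mcoeffZ scalerDl scalerA.
Qed.
HB.instance Definition _ f :=
  GRing.isLinear.Build K {malg K[X]} V _ (malg_lift f) (malg_lift_is_linear f).

Lemma malg_liftU f x : malg_lift f << x >> = f x.
Proof.
by rewrite malg_liftE msuppU oner_eq0 big_seq_fset1 mcoeffUU scale1r.
Qed.

Lemma malg_ext (f g : {linear {malg K[X]} -> V}) :
  (forall x, f << x >> = g << x >>) -> f =1 g.
Proof.
move=> fg p; rewrite [p]monalgE !linear_sum; apply: eq_bigr => x _.
have -> : << p@_x *g x >> = p@_x *: << x >> :> {malg K[X]}.
  by apply/malgP => y; rewrite mcoeffZ !mcoeffU mulr_natr.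
by rewrite !linearZ fg.
Qed.

End FreeModule.

Record quiver := Quiver {
  vertex : finType;
  arrow : finType;
  src : arrow -> vertex;
  tgt : arrow -> vertex }.

Section PathAlgebra.
Variable Q : quiver.

(* A path is its source and its word of arrows, read from left to right. *)
Fixpoint is_path (v : vertex Q) (w : seq (arrow Q)) : bool :=
  if w is a :: w' then (src a == v) && is_path (tgt a) w' else true.

Definition qpath := {p : vertex Q * seq (arrow Q) | is_path p.1 p.2}.
HB.instance Definition _ := Choice.on qpath.

Definition path_src (p : qpath) : vertex Q := (val p).1.
Definition path_tgt (p : qpath) : vertex Q :=
  last (val p).1 (map (@tgt Q) (val p).2).

Definition trivial_path (v : vertex Q) : qpath := exist _ (v, [::]) isT.

Lemma arrow_is_path (a : arrow Q) : is_path (src a) [:: a].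
Proof. by rewrite /= eqxx. Qed.
Definition arrow_path (a : arrow Q) : qpath :=
  exist _ (src a, [:: a]) (arrow_is_path a).

(* Concatenation; only meaningful when path_tgt p = path_src q. *)
Definition path_cat (p q : qpath) : qpath :=
  insubd p ((val p).1, (val p).2 ++ (val q).2).

Lemma is_path_cat v w w' : is_path v (w ++ w') =
  is_path v w && is_path (last v (map (@tgt Q) w)) w'.
Proof. by elim: w v => //= a w IH v; rewrite IH andbA. Qed.

Lemma val_path_cat p q : path_tgt p = path_src q ->
  val (path_cat p q) = ((val p).1, (val p).2 ++ (val q).2).
Proof.
move=> pq; rewrite val_insubd /= is_path_cat.
by move: pq; rewrite /path_tgt /path_src => ->; rewrite (valP p) (valP q).
Qed.

Lemma path_src_cat p q : path_tgt p = path_src q ->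
  path_src (path_cat p q) = path_src p.
Proof. by move=> pq; rewrite {1}/path_src val_path_cat. Qed.

Lemma path_tgt_cat p q : path_tgt p = path_src q ->
  path_tgt (path_cat p q) = path_tgt q.
Proof.
move=> pq; rewrite {1}/path_tgt val_path_cat //= map_cat last_cat.
by rewrite -/(path_tgt p) pq.
Qed.

Variable K : fieldType.

Definition path_algebra := {malg K[qpath]}.
HB.instance Definition _ := GRing.Lmodule.on path_algebra.

Definition path_elt : qpath -> path_algebra :=
  locked_with lock_key (fun p => << p >>).

Definition path_mul (p q : qpath) : path_algebra :=
  if path_tgt p == path_src q then path_elt (path_cat p q) else 0.

Definition pa_mul : path_algebra -> path_algebra -> path_algebra :=
  locked_with lock_key
    (fun g h => malg_lift (fun p => malg_lift (fun q => path_mul p q) h) g).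

Definition pa_one : path_algebra :=
  \sum_(v : vertex Q) path_elt (trivial_path v).

Lemma path_eltE p : path_elt p = << p >>.
Proof. by rewrite /path_elt locked_withE. Qed.
Lemma pa_mulE g h :
  pa_mul g h = malg_lift (fun p => malg_lift (fun q => path_mul p q) h) g.
Proof. by rewrite /pa_mul locked_withE. Qed.

Lemma pa_mulUU p q : pa_mul (path_elt p) (path_elt q) = path_mul p q.
Proof. by rewrite pa_mulE !path_eltE !malg_liftU. Qed.

Lemma pa_mul_linl h : linear (pa_mul^~ h).
Proof. by move=> a g g'; rewrite !pa_mulE linearP. Qed.

Lemma pa_mul_linr g : linear (pa_mul g).
Proof.
move=> a h h'; rewrite !pa_mulE !(malg_liftE _ g) scaler_sumr -big_split /=.
by apply: eq_bigr => p _; rewrite linearP scalerDr !scalerA mulrC.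
Qed.

Lemma pa_ind (P : path_algebra -> Prop) :
  P 0 -> (forall g h, P g -> P h -> P (g + h)) ->
  (forall k g, P g -> P (k *: g)) -> (forall p, P (path_elt p)) -> forall g, P g.
Proof.
move=> P0 PD PZ PU g; rewrite [g](monalgE g); elim/big_ind: _ => // p _.
have -> : << g@_p *g p >> = g@_p *: path_elt p :> path_algebra.
  by rewrite path_eltE; apply/malgP => y; rewrite mcoeffZ !mcoeffU mulr_natr.
exact: PZ.
Qed.

Lemma pa_mulDl : left_distributive pa_mul +%R.
Proof. by move=> g g' h; rewrite -[g]scale1r pa_mul_linl !scale1r. Qed.
Lemma pa_mulDr : right_distributive pa_mul +%R.
Proof. by move=> g h h'; rewrite -[h]scale1r pa_mul_linr !scale1r. Qed.
Lemma pa_mul0 g : pa_mul g 0 = 0.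
Proof. by apply: (addrI (pa_mul g 0)); rewrite -pa_mulDr !addr0. Qed.
Lemma pa_0mul h : pa_mul 0 h = 0.
Proof. by apply: (addrI (pa_mul 0 h)); rewrite -pa_mulDl !addr0. Qed.
Lemma pa_scalerAl k (g h : path_algebra) : k *: pa_mul g h = pa_mul (k *: g) h.
Proof. by rewrite -[k *: g]addr0 pa_mul_linl pa_0mul addr0. Qed.
Lemma pa_scalerAr k (g h : path_algebra) : k *: pa_mul g h = pa_mul g (k *: h).
Proof. by rewrite -[k *: h]addr0 pa_mul_linr pa_mul0 addr0. Qed.

Lemma path_mulA p q r :
  pa_mul (path_elt p) (path_mul q r) = pa_mul (path_mul p q) (path_elt r).
Proof.
rewrite /path_mul.
have [pq|pq] := eqVneq (path_tgt p) (path_src q);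
  have [qr|qr] := eqVneq (path_tgt q) (path_src r) => /=.
- rewrite (pa_mulUU p) (pa_mulUU (path_cat p q)) /path_mul.
  rewrite (path_src_cat qr) (path_tgt_cat pq) pq qr !eqxx.
  congr path_elt; apply: val_inj.
  by rewrite !val_path_cat ?path_src_cat ?path_tgt_cat // catA.
- rewrite (pa_mul0 (path_elt p)) (pa_mulUU (path_cat p q)) /path_mul.
  by rewrite (path_tgt_cat pq) (negPf qr).
- rewrite (pa_0mul (path_elt r)) (pa_mulUU p) /path_mul.
  by rewrite (path_src_cat qr) (negPf pq).
by rewrite (pa_mul0 (path_elt p)) (pa_0mul (path_elt r)).
Qed.

Lemma pa_mulA : associative pa_mul.
Proof.
move=> g h l; elim/pa_ind: g => [|g g' Hg Hg'|k g Hg|p].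
- by rewrite (pa_0mul (pa_mul h l)) (pa_0mul h) (pa_0mul l).
- by rewrite (pa_mulDl g g' h) (pa_mulDl g g') (pa_mulDl (pa_mul g h)) Hg Hg'.
- by rewrite -(pa_scalerAl k g h) -(pa_scalerAl k g) -(pa_scalerAl k (pa_mul g h)) Hg.
elim/pa_ind: h => [|g g' Hg Hg'|k g Hg|q].
- by rewrite (pa_0mul l) (pa_mul0 (path_elt p)) (pa_0mul l).
- rewrite (pa_mulDl g g' l) (pa_mulDr _ g g') (pa_mulDr _ (pa_mul g l)) Hg Hg'.
  by rewrite (pa_mulDl _ _ l).
- rewrite -(pa_scalerAl k g l) -(pa_scalerAr k _ g) -(pa_scalerAr k _ (pa_mul g l)).
  by rewrite Hg (pa_scalerAl k _ l).
elim/pa_ind: l => [|g g' Hg Hg'|k g Hg|r].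
- by rewrite (pa_mul0 (path_elt q)) (pa_mul0 (path_elt p)) (pa_mul0 (pa_mul _ _)).
- by rewrite (pa_mulDr _ g g') (pa_mulDr _ (pa_mul _ g)) (pa_mulDr _ g g') Hg Hg'.
- rewrite -(pa_scalerAr k _ g) -(pa_scalerAr k _ (pa_mul _ g)) Hg.
  by rewrite (pa_scalerAr k _ g).
by rewrite !pa_mulUU path_mulA.
Qed.

Lemma pa_mul1 : left_id pa_one pa_mul.
Proof.
move=> g; elim/pa_ind: g => [|g g' Hg Hg'|k g Hg|p].
- exact: pa_mul0.
- by rewrite (pa_mulDr _ g g') Hg Hg'.
- by rewrite -(pa_scalerAr k _ g) Hg.
rewrite /pa_one (big_morph (pa_mul^~ (path_elt p)) (fun g g' => pa_mulDl g g' _) (pa_0mul _)) /=.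
rewrite (bigD1 (path_src p)) //= big1 => [|v /negPf vp].
  rewrite addr0 pa_mulUU /path_mul eqxx; congr path_elt; apply: val_inj.
  by rewrite val_path_cat //= /path_src; case: p => -[].

by rewrite pa_mulUU /path_mul vp.
Qed.
Lemma pa_1mul : right_id pa_one pa_mul.
Proof.
move=> g; elim/pa_ind: g => [|g g' Hg Hg'|k g Hg|p].
- exact: pa_0mul.
- by rewrite (pa_mulDl g g') Hg Hg'.
- by rewrite -(pa_scalerAl k g) Hg.
rewrite /pa_one (big_morph (pa_mul (path_elt p)) (pa_mulDr _) (pa_mul0 _)) /=.
rewrite (bigD1 (path_tgt p)) //= big1 => [|v].
  rewrite addr0 pa_mulUU /path_mul eqxx; congr path_elt; apply: val_inj.
  by rewrite val_path_cat //= cats0; case: p => -[].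
by rewrite eq_sym => /negPf vp; rewrite pa_mulUU /path_mul vp.
Qed.

HB.instance Definition _ := GRing.Zmodule_isPzRing.Build path_algebra
  pa_mulA pa_mul1 pa_1mul pa_mulDl pa_mulDr.

Lemma path_algebra_scalerAl k (g h : path_algebra) : k *: (g * h) = (k *: g) * h.
Proof. exact: pa_scalerAl. Qed.
Lemma path_algebra_scalerAr k (g h : path_algebra) : k *: (g * h) = g * (k *: h).
Proof. exact: pa_scalerAr. Qed.

End PathAlgebra.

(* The algebra K Q / (rel), for a finite list rel of elements of K Q. *)
Section BoundQuiverAlgebra.
Variables (Q : quiver) (K : fieldType) (rel : seq (path_algebra Q K)).
Local Notation A := (path_algebra Q K).

Lemma ideal_gen_submod : submod_closed (ideal_gen rel).
Proof.
have [[H0 HB] Hl Hr] := ideal_gen_twosided rel; split=> // a u v Hu Hv.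
have HN w : w \in ideal_gen rel -> - w \in ideal_gen rel.
  by move=> Hw; rewrite -[- w]add0r; apply: HB.
rewrite -[v]opprK; apply: HB (HN _ Hv).
by rewrite -[u]mul1r path_algebra_scalerAl; apply: Hl.
Qed.
HB.instance Definition _ :=
  GRing.isSubmodClosed.Build K A (ideal_gen rel) ideal_gen_submod.

Definition bqa := lquot (ideal_gen rel).
HB.instance Definition _ := GRing.Lmodule.on bqa.

Definition to_bqa (x : A) : bqa := to_lquot (ideal_gen rel) x.
Definition of_bqa (q : bqa) : A := of_lquot q.

Lemma to_bqa_is_linear : linear to_bqa.
Proof. exact: to_lquot_is_linear. Qed.
HB.instance Definition _ :=
  GRing.isLinear.Build K A bqa _ to_bqa to_bqa_is_linear.

Lemma of_bqaK q : to_bqa (of_bqa q) = q.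
Proof. exact: of_lquotK. Qed.

Lemma to_bqa_eq x y : (to_bqa x = to_bqa y) <-> (x - y \in ideal_gen rel).
Proof. exact: to_lquot_eq. Qed.

Definition bqa_mul : bqa -> bqa -> bqa :=
  locked_with lock_key (fun p q => to_bqa (of_bqa p * of_bqa q)).

Lemma bqa_mulE p q : bqa_mul p q = to_bqa (of_bqa p * of_bqa q).
Proof. by rewrite /bqa_mul locked_withE. Qed.

Lemma to_bqaM x y : to_bqa (x * y) = bqa_mul (to_bqa x) (to_bqa y).
Proof.
rewrite bqa_mulE; apply/to_bqa_eq.
have E (z t u v : A) : z * t - u * v = z * (t - v) + (z - u) * v.
  by rewrite mulrBr mulrBl addrA addrNK.
rewrite E; apply: rpredD.
  by apply: ideal_genMl; apply/to_bqa_eq; rewrite of_bqaK.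
by apply: ideal_genMr; apply/to_bqa_eq; rewrite of_bqaK.
Qed.

Lemma bqa_mulA : associative bqa_mul.
Proof.
move=> p q r; rewrite -[p]of_bqaK -[q]of_bqaK -[r]of_bqaK.
by rewrite -!to_bqaM mulrA.
Qed.
Lemma bqa_mul1 : left_id (to_bqa 1) bqa_mul.
Proof. by move=> p; rewrite -[p]of_bqaK -!to_bqaM mul1r. Qed.
Lemma bqa_1mul : right_id (to_bqa 1) bqa_mul.
Proof. by move=> p; rewrite -[p]of_bqaK -!to_bqaM mulr1. Qed.
Lemma bqa_mulDl : left_distributive bqa_mul +%R.
Proof.
move=> p q r; rewrite -[p]of_bqaK -[q]of_bqaK -[r]of_bqaK.
by rewrite -linearD -!to_bqaM mulrDl linearD.
Qed.
Lemma bqa_mulDr : right_distributive bqa_mul +%R.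
Proof.
move=> p q r; rewrite -[p]of_bqaK -[q]of_bqaK -[r]of_bqaK.
by rewrite -linearD -!to_bqaM mulrDr linearD.
Qed.
HB.instance Definition _ := GRing.Zmodule_isPzRing.Build bqa
  bqa_mulA bqa_mul1 bqa_1mul bqa_mulDl bqa_mulDr.

Lemma to_bqa_is_monoid_morphism : monoid_morphism to_bqa.
Proof. by split; [exact: erefl | exact: to_bqaM]. Qed.
HB.instance Definition _ :=
  GRing.isMonoidMorphism.Build A bqa to_bqa to_bqa_is_monoid_morphism.

Lemma bqa_scalerAl k (p q : bqa) : k *: (p * q) = (k *: p) * q.
Proof.
rewrite -[p]of_bqaK -[q]of_bqaK -(rmorphM to_bqa) -!(linearZ_LR to_bqa) /=.
by rewrite -(rmorphM to_bqa) path_algebra_scalerAl.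
Qed.
Lemma bqa_scalerAr k (p q : bqa) : k *: (p * q) = p * (k *: q).
Proof.
rewrite -[p]of_bqaK -[q]of_bqaK -(rmorphM to_bqa) -!(linearZ_LR to_bqa) /=.
by rewrite -(rmorphM to_bqa) path_algebra_scalerAr.
Qed.

End BoundQuiverAlgebra.

Reserved Notation "v ⊗ w" (at level 40, left associativity).

Section Tensor.
Variables (K : fieldType) (V W : lmodType K).

Inductive tensor_relation : {malg K[(V * W)%type]} -> Prop :=
| TensorDl v v' w : tensor_relation (<< (v + v', w) >> - << (v, w) >> - << (v', w) >>)
| TensorDr v w w' : tensor_relation (<< (v, w + w') >> - << (v, w) >> - << (v, w') >>)
| TensorZl a v w : tensor_relation (<< (a *: v, w) >> - a *: << (v, w) >>)
| TensorZr a v w : tensor_relation (<< (v, a *: w) >> - a *: << (v, w) >>).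

Definition tensor := lquot (submod_gen tensor_relation).
HB.instance Definition _ := GRing.Lmodule.on tensor.

Definition to_tensor (g : {malg K[(V * W)%type]}) : tensor :=
  to_lquot (submod_gen tensor_relation) g.
Definition of_tensor (t : tensor) : {malg K[(V * W)%type]} := of_lquot t.

Lemma to_tensor_is_linear : linear to_tensor.
Proof. exact: to_lquot_is_linear. Qed.
HB.instance Definition _ :=
  GRing.isLinear.Build K _ tensor _ to_tensor to_tensor_is_linear.

Lemma of_tensorK t : to_tensor (of_tensor t) = t.
Proof. exact: of_lquotK. Qed.

Lemma to_tensor_eq g h :
  (to_tensor g = to_tensor h) <-> (g - h \in submod_gen tensor_relation).
Proof. exact: to_lquot_eq. Qed.

Definition tens : V -> W -> tensor :=
  locked_with lock_key (fun v w => to_tensor << (v, w) >>).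
Local Notation "v ⊗ w" := (tens v w).

Lemma tensE v w : v ⊗ w = to_tensor << (v, w) >>.
Proof. by rewrite /tens locked_withE. Qed.

Lemma tensor_rel0 g : tensor_relation g -> to_tensor g = 0.
Proof.
move=> Hg; rewrite -[RHS](linear0 to_tensor); apply/to_tensor_eq.
by rewrite subr0; apply: mem_submod_gen.
Qed.

Lemma tensDl v v' w : (v + v') ⊗ w = v ⊗ w + v' ⊗ w.
Proof.
have := tensor_rel0 (TensorDl v v' w); rewrite !linearB /= -!tensE => /eqP.
by rewrite subr_eq0 subr_eq => /eqP; rewrite [RHS]addrC.
Qed.
Lemma tensDr v w w' : v ⊗ (w + w') = v ⊗ w + v ⊗ w'.
Proof.
have := tensor_rel0 (TensorDr v w w'); rewrite !linearB /= -!tensE => /eqP.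
by rewrite subr_eq0 subr_eq => /eqP; rewrite [RHS]addrC.
Qed.
Lemma tensZl a v w : (a *: v) ⊗ w = a *: (v ⊗ w).
Proof.
have := tensor_rel0 (TensorZl a v w); rewrite linearB linearZ /= -!tensE => /eqP.
by rewrite subr_eq0 => /eqP.
Qed.
Lemma tensZr a v w : v ⊗ (a *: w) = a *: (v ⊗ w).
Proof.
have := tensor_rel0 (TensorZr a v w); rewrite linearB linearZ /= -!tensE => /eqP.
by rewrite subr_eq0 => /eqP.
Qed.

Lemma tensor_ind (P : tensor -> Prop) :
  P 0 -> (forall t u, P t -> P u -> P (t + u)) ->
  (forall v w, P (v ⊗ w)) -> forall t, P t.
Proof.
move=> P0 PD PU t; rewrite -[t]of_tensorK [of_tensor t]monalgE linear_sum.
elim/big_ind: _ => // -[v w] _; set c := _@__.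
have -> : << c *g (v, w) >> = c *: << (v, w) >> :> {malg K[(V * W)%type]}.
  by apply/malgP => y; rewrite mcoeffZ !mcoeffU mulr_natr.
by rewrite linearZ /= -tensE -tensZl.
Qed.

Section Lift.
Variable U : lmodType K.

Definition bilin (f : V -> W -> U) : Prop :=
  (forall w, linear (f^~ w)) /\ (forall v, linear (f v)).

(* The linear map induced by a bilinear f; see tensor_liftE. *)
Definition tensor_lift : (V -> W -> U) -> tensor -> U :=
  locked_with lock_key (fun f t => malg_lift (fun p => f p.1 p.2) (of_tensor t)).

Variables (f : V -> W -> U) (Hf : bilin f).

Lemma tensor_lift_def t :
  tensor_lift f t = malg_lift (fun p => f p.1 p.2) (of_tensor t).
Proof. by rewrite /tensor_lift locked_withE. Qed.

Lemma tensor_lift_pi g :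
  tensor_lift f (to_tensor g) = malg_lift (fun p => f p.1 p.2) g.
Proof.
rewrite tensor_lift_def; have [fl fr] := Hf; set F := malg_lift _.
pose J : {pred {malg K[(V * W)%type]}} := fun h => F h == 0.
have HJ : submod_closed J.
  split=> [|a u v]; rewrite !unfold_in /J /F; first by rewrite linear0 eqxx.
  by move=> /eqP Fu /eqP Fv; rewrite linearP /= Fu Fv scaler0 addr0.
have : of_tensor (to_tensor g) - g \in submod_gen tensor_relation.
  by apply/to_tensor_eq; rewrite of_tensorK.
move=> /asboolP /(_ J HJ); rewrite !unfold_in /J /F linearB subr_eq0 => H.
have Dl v v' w : f (v + v') w = f v w + f v' w.
  by have := fl w 1 v v'; rewrite !scale1r.
have Dr v w w' : f v (w + w') = f v w + f v w'.
  by have := fr v 1 w w'; rewrite !scale1r.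
have Zl a v w : f (a *: v) w = a *: f v w.
  have f0 : f 0 w = 0 by apply: (addrI (f 0 w)); rewrite -Dl !addr0.
  by have := fl w a v 0; rewrite f0 !addr0.
have Zr a v w : f v (a *: w) = a *: f v w.
  have f0 : f v 0 = 0 by apply: (addrI (f v 0)); rewrite -Dr !addr0.
  by have := fr v a w 0; rewrite f0 !addr0.
apply/eqP/H => h [v v' w|v w w'|a v w|a v w]; rewrite unfold_in /J /F;
  rewrite ?linearB ?linearZ /= !malg_liftU /= ?Dl ?Dr ?Zl ?Zr.
- by rewrite -addrA -opprD subrr.
- by rewrite -addrA -opprD subrr.
- by rewrite -scalerDr subrr scaler0.
by rewrite -scalerDr subrr scaler0.
Qed.

Lemma tensor_liftE v w : tensor_lift f (v ⊗ w) = f v w.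
Proof. by rewrite tensE tensor_lift_pi malg_liftU. Qed.

Lemma tensor_lift_linear : linear (tensor_lift f).
Proof.
move=> a t u; rewrite -[t]of_tensorK -[u]of_tensorK -linearP /=.
by rewrite !tensor_lift_pi linearP.
Qed.

Lemma tensor_liftD t u : tensor_lift f (t + u) = tensor_lift f t + tensor_lift f u.
Proof. by have := tensor_lift_linear 1 t u; rewrite !scale1r. Qed.
Lemma tensor_lift0 : tensor_lift f 0 = 0.
Proof. by apply: (addrI (tensor_lift f 0)); rewrite -tensor_liftD !addr0. Qed.
Lemma tensor_liftZ a t : tensor_lift f (a *: t) = a *: tensor_lift f t.
Proof. by have := tensor_lift_linear a t 0; rewrite tensor_lift0 !addr0. Qed.

End Lift.
End Tensor.

Notation "v ⊗ w" := (tens v w) : ring_scope.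

Section EnvelopingAlgebra.
Variables (Q : quiver) (K : fieldType) (rel : seq (path_algebra Q K)).
Local Notation A := (bqa rel).

(* A^op ⊗ A: the product is (a ⊗ b)(c ⊗ d) = ca ⊗ bd. *)
Definition env : Type := Eval unfold reverse_coercion in tensor A A.
HB.instance Definition _ := GRing.Lmodule.on env.

Definition env_mul : env -> env -> env :=
  locked_with lock_key (fun t u =>
    tensor_lift (fun a b : A =>
      tensor_lift (fun c d : A => (c * a) ⊗ (b * d)) u) t).

Lemma env_mul_def t u : env_mul t u =
  tensor_lift (fun a b : A =>
    tensor_lift (fun c d : A => (c * a) ⊗ (b * d)) u) t.
Proof. by rewrite /env_mul locked_withE. Qed.

Lemma env_bilin_in a b : bilin (fun c d : A => (c * a) ⊗ (b * d)).
Proof.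
split=> [d k c c'|c k d d'].
  by rewrite mulrDl -bqa_scalerAl tensDl tensZl.
by rewrite mulrDr -bqa_scalerAr tensDr tensZr.
Qed.

Lemma env_bilin_out (u : env) : bilin (fun a b : A =>
  tensor_lift (fun c d : A => (c * a) ⊗ (b * d)) u).
Proof.
split=> [b k a a'|a k b b']; elim/tensor_ind: u => [|t t' Ht Ht'|c d].
- by rewrite !(tensor_lift0 (env_bilin_in _ _)) addr0 scaler0.
- by rewrite !(tensor_liftD (env_bilin_in _ _)) Ht Ht' scalerDr addrACA.
- by rewrite !(tensor_liftE (env_bilin_in _ _)) mulrDr -bqa_scalerAr tensDl tensZl.
- by rewrite !(tensor_lift0 (env_bilin_in _ _)) addr0 scaler0.
- by rewrite !(tensor_liftD (env_bilin_in _ _)) Ht Ht' scalerDr addrACA.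
by rewrite !(tensor_liftE (env_bilin_in _ _)) mulrDl -bqa_scalerAl tensDr tensZr.
Qed.

Lemma env_mulE (a b c d : A) :
  env_mul (a ⊗ b) (c ⊗ d) = (c * a) ⊗ (b * d).
Proof.
by rewrite !env_mul_def (tensor_liftE (env_bilin_out _)) (tensor_liftE (env_bilin_in _ _)).
Qed.

Lemma env_mulDl : left_distributive env_mul +%R.
Proof. by move=> t t' u; rewrite !env_mul_def (tensor_liftD (env_bilin_out _)). Qed.
Lemma env_0mul u : env_mul 0 u = 0.
Proof. by rewrite !env_mul_def (tensor_lift0 (env_bilin_out _)). Qed.
Lemma env_mulDr : right_distributive env_mul +%R.
Proof.
move=> t u u'; elim/tensor_ind: t => [|t t' Ht Ht'|a b].
- by rewrite !env_0mul addr0.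
- by rewrite !env_mulDl Ht Ht' addrACA.
by rewrite !env_mul_def !(tensor_liftE (env_bilin_out _)) (tensor_liftD (env_bilin_in _ _)).
Qed.
Lemma env_mul0 t : env_mul t 0 = 0.
Proof. by apply: (addrI (env_mul t 0)); rewrite -env_mulDr !addr0. Qed.

Lemma env_mulA : associative env_mul.
Proof.
move=> t u v; elim/tensor_ind: t => [|t t' Ht Ht'|a b].
- by rewrite !env_0mul.
- by rewrite !env_mulDl Ht Ht'.
elim/tensor_ind: u => [|t t' Ht Ht'|c d].
- by rewrite env_mul0 !env_0mul env_mul0.
- by rewrite env_mulDl !env_mulDr env_mulDl Ht Ht'.
elim/tensor_ind: v => [|t t' Ht Ht'|e f].
- by rewrite !env_mul0.
- by rewrite !env_mulDr Ht Ht'.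
by rewrite !env_mulE !mulrA.
Qed.

Lemma env_mul1 : left_id ((1 : A) ⊗ (1 : A) : env) env_mul.
Proof.
move=> t; elim/tensor_ind: t => [|t t' Ht Ht'|a b].
- exact: env_mul0.
- by rewrite env_mulDr Ht Ht'.
by rewrite env_mulE mulr1 mul1r.
Qed.
Lemma env_1mul : right_id ((1 : A) ⊗ (1 : A) : env) env_mul.
Proof.
move=> t; elim/tensor_ind: t => [|t t' Ht Ht'|a b].
- exact: env_0mul.
- by rewrite env_mulDl Ht Ht'.
by rewrite env_mulE mulr1 mul1r.
Qed.

HB.instance Definition _ := GRing.Zmodule_isPzRing.Build env
  env_mulA env_mul1 env_1mul env_mulDl env_mulDr.

Lemma envE (a b c d : A) : (a ⊗ b : env) * (c ⊗ d : env) = (c * a) ⊗ (b * d).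
Proof. exact: env_mulE. Qed.

(* Right env-modules are left modules over the converse ring env^c. *)
Definition envc : pzRingType := Eval unfold reverse_coercion in env^c.

(* A as a bimodule over itself: x . (a ⊗ b) = a x b. *)
Definition regular_bimodule := A.
HB.instance Definition _ := GRing.Zmodule.on regular_bimodule.
Local Notation RB := regular_bimodule.

Definition regular_act : envc -> RB -> RB :=
  locked_with lock_key (fun (t : env) (x : A) =>
    tensor_lift (fun a b : A => a * x * b) t).

Lemma regular_act_def (t : env) (x : A) :
  regular_act t x = tensor_lift (fun a b : A => a * x * b) t.
Proof. by rewrite /regular_act locked_withE. Qed.

Lemma regular_act_bilin (x : A) : bilin (fun a b : A => a * x * b).
Proof.
split=> [b k a a'|a k b b']; first by rewrite !mulrDl -!bqa_scalerAl.
by rewrite mulrDr -bqa_scalerAr.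
Qed.

Lemma regular_actE (a b x : A) : regular_act (a ⊗ b) x = a * x * b.
Proof. by rewrite regular_act_def (tensor_liftE (regular_act_bilin x)). Qed.
Lemma regular_actDl x : {morph regular_act^~ x : t u / t + u}.
Proof. by move=> t u; rewrite !regular_act_def (tensor_liftD (regular_act_bilin x)). Qed.
Lemma regular_act0 x : regular_act 0 x = 0.
Proof. by rewrite regular_act_def (tensor_lift0 (regular_act_bilin x)). Qed.
Lemma regular_actDr : right_distributive regular_act +%R.
Proof.
move=> t x y; elim/tensor_ind: t => [|t t' Ht Ht'|a b].
- by rewrite !regular_act0 addr0.
- by rewrite !regular_actDl Ht Ht' addrACA.
by rewrite !regular_actE mulrDr mulrDl.
Qed.
Lemma regular_act_0 t : regular_act t 0 = 0.
Proof. by apply: (addrI (regular_act t 0)); rewrite -regular_actDr !addr0. Qed.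
Lemma regular_act1 : left_id 1 regular_act.
Proof. by move=> x; rewrite [LHS]regular_actE mul1r mulr1. Qed.
Lemma regular_actA t u x :
  regular_act t (regular_act u x) = regular_act (t * u) x.
Proof.
rewrite -[t * u]/((u : env) * (t : env)).
elim/tensor_ind: t => [|t t' Ht Ht'|a b].
- by rewrite mulr0 !regular_act0.
- by rewrite mulrDr !regular_actDl Ht Ht'.
elim/tensor_ind: u => [|u u' Hu Hu'|c d].
- by rewrite mul0r !regular_act0 regular_act_0.
- by rewrite mulrDl !regular_actDl regular_actDr Hu Hu'.
by rewrite envE !regular_actE !mulrA.
Qed.

HB.instance Definition _ := GRing.Zmodule_isLmodule.Build envc RB
  regular_actA regular_act1 regular_actDr regular_actDl.

End EnvelopingAlgebra.

Section MinimalResolution.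
Variable R : pzRingType.

Definition projective (P : lmodType R) : Prop :=
  forall (M N : lmodType R) (g : {linear M -> N}) (f : {linear P -> N}),
    (forall y, exists x, g x = y) ->
    exists h : {linear P -> M}, forall x, g (h x) = f x.

Definition superfluous (M : lmodType R) (U : M -> Prop) : Prop :=
  forall L : {pred M}, submod_closed L ->
    (forall x, exists u l, [/\ U u, l \in L & x = u + l]) ->
    forall x, x \in L.

(* ... -> P 1 -> P 0 -> M -> 0 is exact, each P n is projective, and the
   corestrictions P 0 -> M and P n.+1 -> Im (d n) are projective covers. *)
Record minimal_projective_resolution (M : lmodType R) (P : nat -> lmodType R)
    (d : forall n, {linear P n.+1 -> P n}) (eps : {linear P 0%N -> M}) : Prop := {
  mpr_projective : forall n, projective (P n);
  mpr_surj : forall m, exists x, eps x = m;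
  mpr_exact0 : forall x, eps x = 0 <-> exists y, d 0%N y = x;
  mpr_exact : forall n x, d n x = 0 <-> exists y, d n.+1 y = x;
  mpr_cover0 : superfluous (fun x => eps x = 0);
  mpr_cover : forall n, superfluous (fun x => d n x = 0) }.

End MinimalResolution.

(* The arrow (i, false) is a_i and (i, true) is b_i. *)
Definition Gamma (s : nat) : quiver :=
  @Quiver 'I_s ('I_s * bool)%type (fun a => a.1) (fun a => ordS a.1).

Section Lambda.
Variables (K : fieldType) (s : nat).
Local Notation KG := (path_algebra (Gamma s) K).

Definition path_x : KG := \sum_(i < s) path_elt K (@arrow_path (Gamma s) (i, false)).
Definition path_y : KG := \sum_(i < s) path_elt K (@arrow_path (Gamma s) (i, true)).

Definition Lambda_rel : seq KG :=
  [:: path_x ^+ 2; path_x * path_y + path_y * path_x; path_y ^+ 2].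

Local Notation Lambda := (bqa Lambda_rel).

Definition lam_x : Lambda := to_bqa Lambda_rel path_x.
Definition lam_y : Lambda := to_bqa Lambda_rel path_y.
Definition lam_e (i : 'I_s) : Lambda :=
  to_bqa Lambda_rel (path_elt K (@trivial_path (Gamma s) i)).

Definition shift (n : nat) (i : 'I_s) : 'I_s := iter n (@ordS s) i.

Lemma path_eltM (p q : qpath (Gamma s)) :
  path_elt K p * path_elt K q = path_mul K p q.
Proof. exact: pa_mulUU. Qed.

Lemma lam_e_idem i : lam_e i * lam_e i = lam_e i.
Proof.
rewrite /lam_e -rmorphM /= path_eltM /path_mul eqxx; congr (to_bqa _ (path_elt K _)).
by apply: val_inj; rewrite val_path_cat.
Qed.

Lemma path_e_arrows (c : bool) i :
  path_elt K (@trivial_path (Gamma s) i) *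
    (\sum_(k < s) path_elt K (@arrow_path (Gamma s) (k, c))) =
  (\sum_(k < s) path_elt K (@arrow_path (Gamma s) (k, c))) *
    path_elt K (@trivial_path (Gamma s) (ordS i)).
Proof.
transitivity (path_elt K (@arrow_path (Gamma s) (i, c))).
  rewrite mulr_sumr (bigD1 i) //= big1 => [|k ki]; rewrite path_eltM /path_mul.
    rewrite eqxx addr0; congr path_elt; apply: val_inj.
    by rewrite val_path_cat.
  by rewrite eq_sym in ki; rewrite /path_tgt /path_src /= (negPf ki).
rewrite mulr_suml (bigD1 i) //= big1 => [|k ki]; rewrite path_eltM /path_mul.
  rewrite eqxx addr0; congr path_elt; apply: val_inj.
  by rewrite val_path_cat.
by rewrite /path_tgt /path_src /= (inj_eq (can_inj (@ordSK s))) (negPf ki).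
Qed.

Lemma lam_e_x i : lam_e i * lam_x = lam_x * lam_e (ordS i).
Proof. by rewrite /lam_e /lam_x -!rmorphM /= path_e_arrows. Qed.
Lemma lam_e_y i : lam_e i * lam_y = lam_y * lam_e (ordS i).
Proof. by rewrite /lam_e /lam_y -!rmorphM /= path_e_arrows. Qed.

Local Notation E := (env Lambda_rel).
Local Notation Ec := (envc Lambda_rel).

(* Lambda f ⊗ g Lambda, embedded in Lambda ⊗ Lambda (injectively, as K is a
   field). *)
Definition corner (f g : Lambda) : {pred E} := fun t =>
  `[< exists l : seq (Lambda * Lambda),
        t = \sum_(p <- l) ((p.1 * f) ⊗ (g * p.2) : E) >].

Lemma corner_submod f g : @submod_closed Ec Ec^o (corner f g).
Proof.
split=> [|t u v]; first by apply/asboolP; exists [::]; rewrite big_nil.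
move=> /asboolP[lu ->] /asboolP[lv ->].
have : exists l : seq (Lambda * Lambda),
    (\sum_(p <- lu) ((p.1 * f) ⊗ (g * p.2) : E)) * (t : E) =
    \sum_(p <- l) ((p.1 * f) ⊗ (g * p.2) : E).
  elim/tensor_ind: t => [|t t' [l Hl] [l' Hl']|a b].
  - by exists [::]; rewrite big_nil mulr0.
  - by exists (l ++ l'); rewrite big_cat /= mulrDr Hl Hl'.
  exists [seq (a * p.1, p.2 * b) | p <- lu].
  rewrite big_map mulr_suml; apply: eq_bigr => p _.
  by rewrite envE /= !mulrA.
move=> [l Hl]; apply/asboolP; exists (l ++ lv); rewrite big_cat /=.
by congr (_ + _); exact: Hl.
Qed.

Section Resolution.
Variable n : nat.
Local Notation I := ('I_s * 'I_n.+1)%type.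

Definition Q_pred : {pred {ffun I -> Ec^o}} := fun f =>
  [forall p : I, (f p : E) \in corner (lam_e p.1) (lam_e (shift n p.1))].

Lemma Q_submod : submod_closed Q_pred.
Proof.
split=> [|t f g /forallP Hf /forallP Hg]; apply/forallP => p; rewrite ffunE.
  by case: (corner_submod (lam_e p.1) (lam_e (shift n p.1))).
have [_ H] := corner_submod (lam_e p.1) (lam_e (shift n p.1)).
by rewrite ffunE; apply: H; [exact: Hf | exact: Hg].
Qed.

(* The direct sum over (i, j) of the Lambda e_i ⊗ e_(i+n) Lambda. *)
Record Qmod := QMod { Qval : {ffun I -> Ec^o}; Qval_in : Qval \in Q_pred }.
HB.instance Definition _ := [isSub for Qval].
HB.instance Definition _ := [Choice of Qmod by <:].
HB.instance Definition _ :=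
  GRing.SubChoice_isSubLmodule.Build Ec {ffun I -> Ec^o} Q_pred Qmod Q_submod.

Definition Qcoef (q : Qmod) (p : I) : E := Qval q p.

Definition Qgen_fun (i : 'I_s) (j : 'I_n.+1) : {ffun I -> Ec^o} :=
  [ffun p => if p == (i, j) then (lam_e i ⊗ lam_e (shift n i) : E) else 0].

Lemma Qgen_in i j : Qgen_fun i j \in Q_pred.
Proof.
apply/forallP => p; rewrite ffunE; case: eqP => [->|_] /=.
  apply/asboolP; exists [:: (1, 1)].
  by rewrite big_seq1 /= mul1r mulr1.
by case: (corner_submod (lam_e p.1) (lam_e (shift n p.1))).
Qed.

(* The generator b_{i,j}^n. *)
Definition Qgen i j : Qmod := QMod (Qgen_in i j).

Lemma Qcoef_gen i j p :
  Qcoef (Qgen i j) p = if p == (i, j) then (lam_e i ⊗ lam_e (shift n i) : E) else 0.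
Proof. by rewrite /Qcoef /= ffunE. Qed.

Lemma Qcoef_linear (t : Ec) q q' p :
  Qcoef (t *: q + q') p = Qcoef q p * (t : E) + Qcoef q' p.
Proof. by rewrite /Qcoef /= !ffunE. Qed.

Lemma Qcoef_inj q q' : (forall p, Qcoef q p = Qcoef q' p) -> q = q'.
Proof. by move=> H; apply: val_inj; apply/ffunP => p; apply: H. Qed.

(* Sends q = \sum_p Qgen p . (Qcoef q p) to \sum_p D p . (Qcoef q p); it maps
   Qgen p to D p as soon as D p is fixed by e_i ⊗ e_(i+n), p = (i, j);
   see Qext_gen and Qgen_span. *)
Definition Qext (M : lmodType Ec) (D : I -> M) (q : Qmod) : M :=
  \sum_p (Qcoef q p : Ec) *: D p.

Lemma Qext_linear (M : lmodType Ec) (D : I -> M) : linear (Qext D).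
Proof.
move=> t q q'; rewrite /Qext scaler_sumr -big_split /=.
by apply: eq_bigr => p _; rewrite Qcoef_linear scalerDl scalerA.
Qed.

Lemma Qext_gen (M : lmodType Ec) (D : I -> M) i j :
  Qext D (Qgen i j) = (lam_e i ⊗ lam_e (shift n i) : Ec) *: D (i, j).
Proof.
rewrite /Qext (bigD1 (i, j)) //= Qcoef_gen eqxx big1 ?addr0 // => p /negPf pN.
by rewrite Qcoef_gen pN scale0r.
Qed.

Lemma corner_fixed f g t : f * f = f -> g * g = g -> t \in corner f g ->
  (f ⊗ g : E) * t = t.
Proof.
move=> ff gg /asboolP[l ->]; rewrite mulr_sumr; apply: eq_bigr => p _.
by rewrite envE -mulrA ff mulrA gg.
Qed.

Lemma Qcoef_fixed q p :
  (lam_e p.1 ⊗ lam_e (shift n p.1) : E) * Qcoef q p = Qcoef q p.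
Proof.
have /forallP/(_ p) := Qval_in q.
by apply: corner_fixed; apply: lam_e_idem.
Qed.

Lemma Qgen_span q : q = Qext (fun p => Qgen p.1 p.2) q.
Proof.
apply: Qcoef_inj => p; have -> : Qcoef (Qext (fun p => Qgen p.1 p.2) q) p =
    \sum_r (Qcoef (Qgen r.1 r.2) p * Qcoef q r).
  rewrite /Qext (big_morph (fun q => Qcoef q p) (id1 := 0) (op1 := +%R)).
  - apply: eq_bigr => r _; rewrite -[_ *: _]addr0 Qcoef_linear.
    by rewrite [Qcoef 0 p]/Qcoef /= ffunE addr0.
  - by move=> u v; rewrite -[u]scale1r Qcoef_linear scale1r; congr (_ + _); apply: mulr1.
  by rewrite /Qcoef /= ffunE.
rewrite (bigD1 p) //= big1 ?addr0 => [|r rp]; rewrite Qcoef_gen -surjective_pairing.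
  by rewrite eqxx Qcoef_fixed.
by rewrite eq_sym (negPf rp) mul0r.
Qed.

End Resolution.

(* a . m and m . a, for a bimodule m. *)
Definition mulL (M : lmodType Ec) (a : Lambda) (m : M) : M :=
  (a ⊗ (1 : Lambda) : Ec) *: m.
Definition mulR (M : lmodType Ec) (m : M) (a : Lambda) : M :=
  ((1 : Lambda) ⊗ a : Ec) *: m.
Local Notation "a *< m" := (mulL a m) (at level 40).
Local Notation "m >* a" := (mulR m a) (at level 40).

(* The prescribed image of the generator b_{i,j}^{n+1}. *)
Definition Qdiff_gen n (p : 'I_s * 'I_n.+2) : Qmod n :=
  let: (i, j) := p in
  let b k : Qmod n := Qgen i (inord k) in
  let b' k : Qmod n := Qgen (ordS i) (inord k) in
  let sgn : Ec := (-1) ^+ n.+1 in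
  if j == 0%N :> nat then b 0%N >* lam_y + sgn *: (lam_y *< b' 0%N)
  else if j == n.+1 :> nat then b n >* lam_x + sgn *: (lam_x *< b' n)
  else (b j.-1 >* lam_x + b j >* lam_y)
       + sgn *: (lam_y *< b' j + lam_x *< b' j.-1).

Definition Qdiff n : Qmod n.+1 -> Qmod n := Qext (@Qdiff_gen n).
HB.instance Definition _ n :=
  GRing.isLinear.Build Ec (Qmod n.+1) (Qmod n) _ (@Qdiff n)
    (Qext_linear (@Qdiff_gen n)).

Lemma Qgen_fixed n i j :
  (lam_e i ⊗ lam_e (shift n i) : Ec) *: Qgen (n := n) i j = Qgen i j.
Proof.
apply: Qcoef_inj => p; rewrite -[_ *: _]addr0 Qcoef_linear.
rewrite [Qcoef 0 p]/Qcoef /= ffunE addr0 Qcoef_gen; case: eqP => _; last exact: mul0r.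
by rewrite envE !lam_e_idem.
Qed.

Lemma shiftS n i : shift n (ordS i) = shift n.+1 i.
Proof. exact: esym (iterSr n _ i). Qed.

Lemma Qgen_mulR n i (j : 'I_n.+1) (z : Lambda) :
  (forall k, lam_e k * z = z * lam_e (ordS k)) ->
  (lam_e i ⊗ lam_e (shift n.+1 i) : Ec) *: (Qgen i j >* z) = Qgen i j >* z.
Proof.
move=> ez; rewrite /mulR -Qgen_fixed !scalerA.
rewrite -![_ * _ :> Ec]/((_ : E) * (_ : E)) !envE.
rewrite -[shift n.+1 i]/(ordS (shift n i)) -ez !mulr1 !mul1r lam_e_idem.
by rewrite mulrA lam_e_idem.
Qed.

Lemma Qgen_mulL n i (j : 'I_n.+1) (z : Lambda) :
  (forall k, lam_e k * z = z * lam_e (ordS k)) ->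
  (lam_e i ⊗ lam_e (shift n.+1 i) : Ec) *: (z *< Qgen (ordS i) j) =
  z *< Qgen (ordS i) j.
Proof.
move=> ez; rewrite /mulL -Qgen_fixed !scalerA.
rewrite -![_ * _ :> Ec]/((_ : E) * (_ : E)) !envE shiftS.
by rewrite ?(mulr1, mul1r) ez -mulrA !lam_e_idem.
Qed.

Lemma Qdiff_genE n i j : Qdiff (Qgen (n := n.+1) i j) = Qdiff_gen (i, j).
Proof.
rewrite /Qdiff Qext_gen /Qdiff_gen.
have sgnC (t : Ec) (q : Qmod n) :
    t *: (((-1) ^+ n.+1 : Ec) *: q) = ((-1) ^+ n.+1 : Ec) *: (t *: q).
  by rewrite !scalerA; congr (_ *: _); apply: commrX; apply: commrN1.
have [H1 H2] := (lam_e_x, lam_e_y).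
case: ifP => _; last case: ifP => _;
  by rewrite !scalerDr !sgnC ?scalerDr ?(Qgen_mulR, Qgen_mulL).
Qed.

Definition env_prod (t : E) : Lambda := tensor_lift (fun a b : Lambda => a * b) t.

Lemma env_prodE t : env_prod t = regular_act (t : Ec) (1 : Lambda).
Proof.
rewrite regular_act_def /env_prod; congr (tensor_lift _ t).
by apply/funext => a; apply/funext => b; rewrite mulr1.
Qed.

(* The multiplication map Q^0 -> Lambda. *)
Definition Qaug (q : Qmod 0) : regular_bimodule Lambda_rel :=
  \sum_p env_prod (Qcoef q p).

Lemma Qaug_linear : linear Qaug.
Proof.
move=> t q q'; rewrite /Qaug scaler_sumr -big_split /=.
apply: eq_bigr => p _; rewrite Qcoef_linear !env_prodE.
by rewrite regular_actDl -[_ * (t : E)]/((t : Ec) * (Qcoef q p : Ec)) -regular_actA.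
Qed.
HB.instance Definition _ :=
  GRing.isLinear.Build Ec (Qmod 0) (regular_bimodule Lambda_rel) _ Qaug Qaug_linear.

Lemma Qaug_gen i j : Qaug (Qgen i j) = lam_e i.
Proof.
rewrite /Qaug (bigD1 (i, j)) //= big1 => [|p /negPf pN]; rewrite Qcoef_gen.
  by rewrite eqxx addr0 env_prodE regular_actE mulr1 lam_e_idem.
by rewrite pN env_prodE regular_act0.
Qed.

End Lambda.

(* Main.v *)
Require Import Defs.
From HB Require Import structures.
From mathcomp Require Import all_boot all_algebra.
From mathcomp Require Import boolp zify.
Import GRing.Theory.
Local Open Scope ring_scope.

(** The algebra Lambda_s has the K-basis e_i, e_i x, e_i y, e_i xy: it is an
    exterior algebra in two variables spread over s vertices.  The complex Q is
    its Koszul bimodule complex, the generator b_{i,j}^n standing for the sum of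
    all words from i with j letters x and n - j letters y.

    Exactness comes from an explicit contracting homotopy h that commutes with
    the right action of Lambda_s.  The exterior algebra on x alone has the
    homotopy that turns x b^n into b^{n+1} up to sign and kills b^n.  The complex
    Q is the twisted tensor product of the complexes for x and for y, and the
    usual formula for a tensor product, h_x ⊗ 1 + p_x ⊗ h_y with p_x the section
    of the augmentation composed with the augmentation, gives, up to signs,
      h(b_j) = 0,   h(x b_j) = b_{j+1},   h(y b_j) = [j = 0] b_0,
      h(xy b_j) = y b_{j+1} + [j = 0] b_0 x.
    The identity d h + h d = 1 (lemma homotopy_id) is then a finite check, as is
    its variant in degree 0 with the section a |-> sum_i b_{i,0} a of the
    augmentation (lemma homotopy_id0).  Building h requires K-linear maps on
    Lambda_s with prescribed values on the basis; these come from linear maps on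
    the path algebra that vanish on the relations (lemma path_lift_ideal), which
    amounts to the linear independence of the basis.

    Each Q^n is projective because a morphism out of it is freely determined by
    the images of the generators, fixed by the idempotents e_i ⊗ e_{i+n}.  For
    minimality, the kernels are images of the differential by exactness, and
    every term of the differential carries a letter x or y.  A product of three
    letters vanishes in Lambda_s, so a bimodule element carrying five letters on
    its two sides is 0: if Q = ker + L then, by descending induction on the number
    of letters, everything lies in L (lemma Qdiff_image_superfluous). *)

Section Resolution.
Context {K : fieldType} {s : nat}.
Local Notation G := (Gamma s).
Local Notation KG := (path_algebra G K).
Local Notation rel := (Lambda_rel K s).
Local Notation Lambda := (bqa rel).
Local Notation E := (env rel).
Local Notation Ec := (envc rel).
Local Notation x := (lam_x K s).
Local Notation y := (lam_y K s).
Local Notation e := (@lam_e K s).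
Local Notation Q := (Qmod K s).

(** * Paths and words in the letters x and y *)

(** The letter x is encoded by false and y by true, as for the arrows. *)
Definition path_letter (c : bool) : KG :=
  \sum_(i < s) path_elt K (@arrow_path G (i, c)).

Definition path_word (p : qpath G) : seq bool := map snd (val p).2.

Definition path_rcons (p : qpath G) (c : bool) : qpath G :=
  path_cat p (@arrow_path G (path_tgt p, c)).

Lemma val_path_rcons p c :
  val (path_rcons p c) = ((val p).1, rcons (val p).2 (path_tgt p, c)).
Proof. by rewrite val_path_cat //= cats1. Qed.

Lemma path_word_rcons p c : path_word (path_rcons p c) = rcons (path_word p) c.
Proof. by rewrite /path_word val_path_rcons map_rcons. Qed.

Lemma path_src_rcons p c : path_src (path_rcons p c) = path_src p.
Proof. by rewrite /path_src val_path_rcons. Qed.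

(** Only one arrow of each kind leaves a given vertex, so a single summand of
    the letter survives. *)
Lemma path_elt_letter p c :
  path_elt K p * path_letter c = path_elt K (path_rcons p c).
Proof.
rewrite /path_letter mulr_sumr (bigD1 (path_tgt p)) //= big1 => [|k kp].
  by rewrite addr0 path_eltM /path_mul eqxx.
by rewrite path_eltM /path_mul eq_sym (negPf kp).
Qed.

Definition lam_letter (c : bool) : Lambda := if c then y else x.

Definition lam_word (w : seq bool) : Lambda := \prod_(c <- w) lam_letter c.

Lemma lam_letterE c : lam_letter c = to_bqa rel (path_letter c).
Proof. by case: c. Qed.

Lemma lam_word0 : lam_word [::] = 1.
Proof. by rewrite /lam_word big_nil. Qed.

Lemma lam_word1 c : lam_word [:: c] = lam_letter c.
Proof. by rewrite /lam_word big_seq1. Qed.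

Lemma lam_word_cons c w : lam_word (c :: w) = lam_letter c * lam_word w.
Proof. by rewrite /lam_word big_cons. Qed.

Lemma lam_word_cat w w' : lam_word (w ++ w') = lam_word w * lam_word w'.
Proof. by rewrite /lam_word big_cat. Qed.

Lemma lam_path p :
  to_bqa rel (path_elt K p) = e (path_src p) * lam_word (path_word p).
Proof.
case: p => -[v w]; elim/last_ind: w => [|w a IH] pP.
  by rewrite lam_word0 mulr1; congr (to_bqa _ (path_elt _ _)); apply: val_inj.
have pw : @is_path G v w by move: (pP); rewrite /= -cats1 is_path_cat => /andP[].
pose p : qpath G := exist _ (v, w) pw.
have -> : exist _ (v, rcons w a) pP = path_rcons p a.2.
  apply: val_inj; rewrite val_path_rcons /=; congr (v, rcons w _).
  move: pP; rewrite /= -cats1 is_path_cat /= andbT => /andP[_ /eqP].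
  by case: a => u c /= ->.
rewrite -path_elt_letter rmorphM /= (IH pw) -lam_letterE path_word_rcons path_src_rcons.
by rewrite -cats1 lam_word_cat lam_word1 mulrA.
Qed.

Lemma lam_xx : x * x = 0.
Proof.
rewrite /lam_x -rmorphM -(linear0 (to_bqa rel)); apply/to_bqa_eq.
by rewrite subr0; apply: mem_ideal_gen; rewrite !inE eqxx.
Qed.

Lemma lam_yy : y * y = 0.
Proof.
rewrite /lam_y -rmorphM -(linear0 (to_bqa rel)); apply/to_bqa_eq.
by rewrite subr0; apply: mem_ideal_gen; rewrite !inE eqxx !orbT.
Qed.

Lemma lam_yx : y * x = - (x * y).
Proof.
apply/eqP; rewrite -addr_eq0 /lam_x /lam_y -!rmorphM -rmorphD.
rewrite -(linear0 (to_bqa rel)); apply/eqP/to_bqa_eq.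
by rewrite subr0 addrC; apply: mem_ideal_gen; rewrite !inE eqxx orbT.
Qed.

Lemma lam_e_mul i j : e i * e j = if i == j then e i else 0.
Proof.
case: eqVneq => [->|ij]; first exact: lam_e_idem.
rewrite /lam_e -rmorphM /= path_eltM /path_mul.
by rewrite /path_tgt /path_src /= (negPf ij) linear0.
Qed.

Lemma lam_e_sum : \sum_i e i = 1.
Proof. by rewrite /lam_e -linear_sum. Qed.

Lemma lam_e_letter i c : e i * lam_letter c = lam_letter c * e (ordS i).
Proof. by case: c; [exact: lam_e_y | exact: lam_e_x]. Qed.

Lemma lam_e_word i w : e i * lam_word w = lam_word w * e (shift (size w) i).
Proof.
elim: w i => [|c w IH] i; first by rewrite lam_word0 mul1r mulr1.
by rewrite lam_word_cons mulrA lam_e_letter -mulrA IH mulrA /= shiftS.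
Qed.

(** Among three letters two are equal, and they can be made adjacent. *)
Lemma lam_word_long w : (2 < size w)%N -> lam_word w = 0.
Proof.
case: w => [|a [|b [|c w]]] // _; rewrite !lam_word_cons !mulrA.
suff -> : lam_letter a * lam_letter b * lam_letter c = 0 by rewrite mul0r.
case: a b c => -[] [] /=; rewrite ?lam_xx ?lam_yy ?mul0r //.
- by rewrite lam_yx mulNr -mulrA lam_yy mulr0 oppr0.
- by rewrite -mulrA lam_xx mulr0.
- by rewrite -mulrA lam_yy mulr0.
by rewrite -mulrA lam_yx mulrN mulrA lam_xx mul0r oppr0.
Qed.

Lemma lam_ind (P : Lambda -> Prop) :
  P 0 -> (forall a b, P a -> P b -> P (a + b)) ->
  (forall k i w, P (k *: (e i * lam_word w))) -> forall a, P a.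
Proof.
move=> P0 PD PW a; rewrite -[a]of_bqaK.
suff H : forall z k, P (k *: to_bqa rel z) by rewrite -[to_bqa _ _]scale1r.
move=> z; elim/pa_ind: z => [|g h Hg Hh|l g Hg|p] k.
- by rewrite linear0 scaler0.
- by rewrite linearD scalerDr; apply: PD.
- by rewrite linearZ /= scalerA.
by rewrite lam_path.
Qed.

(** * Linear maps prescribed on the basis of Lambda *)

Section Lift.
Context {V : lmodType K} (f1 fx fy fxy : 'I_s -> V).

(** The value on the path from v with word w that the relations force, once the
    values f1 v, fx v, fy v, fxy v on e_v, e_v x, e_v y, e_v xy are chosen. *)
Definition word_val (v : 'I_s) (w : seq bool) : V :=
  match w with
  | [::] => f1 v
  | [:: c] => if c then fy v else fx v
  | [:: c; d] => if c == d then 0 else if c then - fxy v else fxy v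
  | _ => 0
  end.

Lemma word_val_anticomm v w w' c d :
  word_val v (w ++ c :: d :: w') + word_val v (w ++ d :: c :: w') = 0.
Proof.
case: w => [|a [|b [|l w]]]; case: w' => [|a' w'] /=; rewrite ?addr0 //.
by case: c d => -[]; rewrite /= ?addr0 ?addNr ?addrN.
Qed.

Lemma word_val_sq v w w' c : word_val v (w ++ c :: c :: w') = 0.
Proof. by case: w => [|a [|b [|l w]]]; case: w' => [|a' w'] //=; rewrite eqxx. Qed.

Definition path_lift : KG -> V :=
  malg_lift (fun p : qpath G => word_val (path_src p) (path_word p)).

Lemma path_lift_elt p :
  path_lift (path_elt K p) = word_val (path_src p) (path_word p).
Proof. by rewrite path_eltE /path_lift malg_liftU. Qed.

Lemma path_lift_linear : linear path_lift.
Proof. by move=> a u v; rewrite /path_lift linearP. Qed.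
HB.instance Definition _ :=
  GRing.isLinear.Build K KG V _ path_lift path_lift_linear.

Lemma path_lift_letters p c d q :
  path_lift (path_elt K p * (path_letter c * path_letter d) * path_elt K q) =
  if shift 2 (path_tgt p) == path_src q
  then word_val (path_src p) (path_word p ++ c :: d :: path_word q) else 0.
Proof.
have tgt2 : path_tgt (path_rcons (path_rcons p c) d) = shift 2 (path_tgt p).
  by rewrite /path_rcons !path_tgt_cat.
rewrite mulrA !path_elt_letter path_eltM /path_mul tgt2.
case: eqP => E; last exact: linear0.
rewrite path_lift_elt path_src_cat ?path_src_rcons ?tgt2 //.
rewrite {1}/path_word val_path_cat ?tgt2 //.
by rewrite !val_path_rcons /= map_cat !map_rcons -!cats1 -!catA.
Qed.

(** The elements z such that u z v is always killed form a two-sided ideal; that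
    it contains the relations needs to be checked for paths u and v only. *)
Lemma path_lift_ideal z : z \in ideal_gen rel -> path_lift z = 0.
Proof.
pose J : {pred KG} := fun z => `[< forall u v, path_lift (u * z * v) = 0 >].
have HJ : twosided_ideal J.
  split=> [|a u /asboolP Hu|a u /asboolP Hu].
  - split=> [|u v /asboolP Hu /asboolP Hv]; apply/asboolP => a b.
      by rewrite mulr0 mul0r linear0.
    by rewrite mulrBr mulrBl linearB /= Hu Hv subr0.
  - by apply/asboolP => b c; rewrite !mulrA Hu.
  by apply/asboolP => b c; rewrite (mulrA b) -(mulrA (b * u)) Hu.
move=> /asboolP /(_ J HJ) H; have: z \in J.
  apply: H => {z} z zrel; apply/asboolP => u v.
  elim/pa_ind: u => [|g h Hg Hh|k g Hg|p]; rewrite ?mul0r ?linear0 //.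
  - by rewrite !mulrDl linearD /= Hg Hh addr0.
  - by rewrite -!path_algebra_scalerAl linearZ /= Hg scaler0.
  elim/pa_ind: v => [|g h Hg Hh|k g Hg|q]; rewrite ?mulr0 ?linear0 //.
  - by rewrite !mulrDr linearD /= Hg Hh addr0.
  - by rewrite -!path_algebra_scalerAr linearZ /= Hg scaler0.
  move: zrel; rewrite -[Lambda_rel K s]/[:: path_letter false ^+ 2;
    path_letter false * path_letter true + path_letter true * path_letter false;
    path_letter true ^+ 2] !inE => /or3P[] /eqP ->.
  - by rewrite expr2 path_lift_letters word_val_sq; case: ifP.
  - rewrite mulrDr mulrDl linearD /= !path_lift_letters.
    by case: ifP => _; rewrite ?word_val_anticomm // addr0.
  by rewrite expr2 path_lift_letters word_val_sq; case: ifP.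
by move=> /asboolP/(_ 1 1); rewrite mul1r mulr1.
Qed.

Definition lam_lift (a : Lambda) : V := path_lift (of_bqa a).

Lemma lam_lift_pi z : lam_lift (to_bqa rel z) = path_lift z.
Proof.
apply/eqP; rewrite -subr_eq0 /lam_lift -linearB; apply/eqP/path_lift_ideal.
by apply/to_bqa_eq; rewrite of_bqaK.
Qed.

Lemma lam_lift_linear : linear lam_lift.
Proof.
move=> k a b; rewrite -[a]of_bqaK -[b]of_bqaK -linearP !lam_lift_pi.
exact: linearP.
Qed.
HB.instance Definition _ :=
  GRing.isLinear.Build K Lambda V _ lam_lift lam_lift_linear.

Lemma lam_lift_word i w :
  lam_lift (lam_word w * e (shift (size w) i)) = word_val i w.
Proof.
have [p [<- <-]] : exists p : qpath G, path_src p = i /\ path_word p = w.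
  elim/last_ind: w => [|w c [p [<- <-]]]; first by exists (@trivial_path G i).
  by exists (path_rcons p c); rewrite path_src_rcons path_word_rcons.
by rewrite -lam_e_word -lam_path lam_lift_pi path_lift_elt.
Qed.

End Lift.

(** * Bimodules and signs *)

Section Action.
Context {M : lmodType Ec}.
Implicit Types (a c : Lambda) (m : M).

(** The bimodule product a m c. *)
Definition bact a c m : M := (a ⊗ c : Ec) *: m.

Lemma bactA a c a' c' m : bact a c (bact a' c' m) = bact (a * a') (c' * c) m.
Proof. by rewrite /bact scalerA -[_ * _ :> Ec]/((_ : E) * (_ : E)) envE. Qed.

Lemma bactD a c m m' : bact a c (m + m') = bact a c m + bact a c m'.
Proof. exact: scalerDr. Qed.
Lemma bactm0 a c : bact a c 0 = 0.
Proof. exact: scaler0. Qed.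
Lemma bactN a c m : bact a c (- m) = - bact a c m.
Proof. exact: scalerN. Qed.
Lemma bactDl a a' c m : bact (a + a') c m = bact a c m + bact a' c m.
Proof. by rewrite /bact tensDl -[RHS]scalerDl. Qed.
Lemma bactDr a c c' m : bact a (c + c') m = bact a c m + bact a c' m.
Proof. by rewrite /bact tensDr -[RHS]scalerDl. Qed.
Lemma bact0l c m : bact 0 c m = 0.
Proof. by apply: (addrI (bact 0 c m)); rewrite -bactDl !addr0. Qed.
Lemma bact0r a m : bact a 0 m = 0.
Proof. by apply: (addrI (bact a 0 m)); rewrite -bactDr !addr0. Qed.
Lemma bactNl a c m : bact (- a) c m = - bact a c m.
Proof. by apply/eqP; rewrite -addr_eq0 -bactDl addNr bact0l. Qed.
Lemma bactNr a c m : bact a (- c) m = - bact a c m.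
Proof. by apply/eqP; rewrite -addr_eq0 -bactDr addNr bact0r. Qed.
Lemma bactZ k a c m : bact (k *: a) c m = bact a (k *: c) m.
Proof. by rewrite /bact tensZl tensZr. Qed.

End Action.

Section Sign.
Context {V : zmodType}.
Implicit Types v w : V.

Definition sgn n v : V := if odd n then - v else v.

Lemma sgnS n v : sgn n.+1 v = - sgn n v.
Proof. by rewrite /sgn /=; case: odd; rewrite ?opprK. Qed.
Lemma sgnD n v w : sgn n (v + w) = sgn n v + sgn n w.
Proof. by rewrite /sgn; case: odd; rewrite ?opprD. Qed.
Lemma sgnN n v : sgn n (- v) = - sgn n v.
Proof. by rewrite /sgn; case: odd. Qed.
Lemma sgnK n v : sgn n (sgn n v) = v.
Proof. by rewrite /sgn; case: odd; rewrite ?opprK. Qed.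
Lemma sgn0 n : sgn n (0 : V) = 0.
Proof. by rewrite /sgn oppr0; case: odd. Qed.

End Sign.
Local Notation sgnE := (sgnD, sgnN, sgnS, opprK, sgnK, opprD, sgn0).

Lemma scale_sgn (M : lmodType Ec) n (m : M) : ((-1) ^+ n : Ec) *: m = sgn n m.
Proof. by rewrite -signr_odd scaler_sign. Qed.

Lemma bact_sgn (M : lmodType Ec) n a c (m : M) :
  bact a c (sgn n m) = sgn n (bact a c m).
Proof. by rewrite /sgn; case: odd; rewrite ?bactN. Qed.

(** * Generators of the terms of the complex *)

Lemma Qgen_bact n i (j : 'I_n.+1) :
  bact (e i) (e (shift n i)) (Qgen K i j) = Qgen K i j.
Proof. exact: Qgen_fixed. Qed.

(** The idempotent e_i of b_{i,j} leaves from Lambda on its left only the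
    words. *)
Lemma Qmod_ind n (P : Q n -> Prop) :
  P 0 -> (forall q r, P q -> P r -> P (q + r)) ->
  (forall w c i j, P (bact (lam_word w) c (Qgen K i j))) -> forall q, P q.
Proof.
move=> P0 PD PW q; rewrite [q]Qgen_span /Qext.
elim/big_ind: _ => // -[i j] _ /=.
move: (Qcoef q _) => t; elim/tensor_ind: t => [|t u Ht Hu|a c].
- by rewrite scale0r.
- by rewrite (scalerDl _ (t : Ec)); exact: PD.
rewrite -[_ *: _]/(bact a c (Qgen K i j)).
elim/lam_ind: a => [|a b Ha Hb|k m w].
- by rewrite bact0l.
- by rewrite bactDl; apply: PD.
rewrite bactZ lam_e_word -Qgen_bact bactA -mulrA lam_e_mul.
case: eqVneq => [->|_]; last by rewrite mulr0 bact0l.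
by rewrite -bactA Qgen_bact; exact: PW.
Qed.

Lemma Qmod_word_ind n (P : Q n -> Prop) :
  P 0 -> (forall q r, P q -> P r -> P (q + r)) ->
  (forall k w w' i j, P (bact (k *: lam_word w) (lam_word w') (Qgen K i j))) ->
  forall q, P q.
Proof.
move=> P0 PD PW; apply: Qmod_ind => // w c i j.
elim/lam_ind: c => [|c c' Hc Hc'|k m w'].
- by rewrite bact0r.
- by rewrite bactDr; apply: PD.
rewrite -bactZ -Qgen_bact bactA mulrA lam_e_mul.
case: ifP => _; last by rewrite mul0r bact0r.
by rewrite -bactA Qgen_bact; exact: PW.
Qed.

Lemma Qmod_ext n (M : zmodType) (f g : Q n -> M) :
  (forall q r, f (q + r) = f q + f r) -> (forall q r, g (q + r) = g q + g r) ->
  (forall w c i j, f (bact (lam_word w) c (Qgen K i j)) =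
                   g (bact (lam_word w) c (Qgen K i j))) -> f =1 g.
Proof.
move=> fD gD fg; elim/Qmod_ind => [|q r Hq Hr|//]; last by rewrite fD gD Hq Hr.
have f0 : f 0 = 0 by apply: (addrI (f 0)); rewrite -fD !addr0.
by rewrite f0; apply: (addrI (g 0)); rewrite -gD !addr0.
Qed.

(** genS n i k is b_{i,k-1}^n, extended by 0 outside the range of the second
    index.  With the index shifted by one, b_{i,-1} exists, and the three cases
    in the definition of the differential become one (lemma Qdiff_genS). *)
Definition genS (n : nat) (i : 'I_s) (k : nat) : Q n :=
  if (0 < k <= n.+1)%N then Qgen K i (inord k.-1) else 0.
Local Notation b := genS.

Lemma genS_ord n i (j : 'I_n.+1) : b n i j.+1 = Qgen K i j.
Proof. by rewrite /genS /= ltn_ord inord_val. Qed.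

Lemma genS0 n i : b n i 0 = 0.
Proof. by []. Qed.

Lemma genS_out n i k : (n.+1 < k)%N -> b n i k = 0.
Proof. by rewrite /genS ltnNge => /negPf ->; rewrite andbF. Qed.

Lemma genS_fix n i k a c :
  bact (a * e i) (e (shift n i) * c) (b n i k) = bact a c (b n i k).
Proof.
by rewrite -bactA /genS; case: ifP => _; rewrite ?bactm0 // Qgen_bact.
Qed.

Lemma Qdiff_genS n i k :
  Qdiff (b n.+1 i k.+1) = bact 1 x (b n i k) + bact 1 y (b n i k.+1) +
    sgn n.+1 (bact y 1 (b n (ordS i) k.+1) + bact x 1 (b n (ordS i) k)).
Proof.
case: (ltnP k n.+2) => [kn|nk]; last first.
  have nk' : (n.+1 < k.+1)%N by exact: leqW.
  rewrite (@genS_out n.+1 _ k.+1) // !(genS_out _ _ _ nk) !(genS_out _ _ _ nk').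
  by rewrite !bactm0 addr0 sgn0 addr0 linear0.
rewrite (genS_ord _ i (Ordinal kn)) Qdiff_genE /Qdiff_gen /= !scale_sgn.
rewrite /mulR /mulL -!/(bact _ _ _).
case: (posnP k) => [->|k0]; first by rewrite !genS0 !bactm0 add0r addr0.
case: eqVneq => [->|kn'].
  by rewrite !(genS_out _ _ _ (ltnSn n.+1)) !bactm0 addr0 add0r /genS /= leqnn.
have k1 : (k.-1 < n.+1)%N by rewrite prednK.
have k2 : (k < n.+1)%N by rewrite ltn_neqAle kn'.
by rewrite /genS k0 /= k2 (ltnW k2).
Qed.

Lemma Qdiff_bact n a c i k :
  Qdiff (bact a c (b n.+1 i k.+1)) =
  bact a (x * c) (b n i k) + bact a (y * c) (b n i k.+1) +
  sgn n.+1 (bact (a * y) c (b n (ordS i) k.+1) + bact (a * x) c (b n (ordS i) k)).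
Proof.
rewrite /bact linearZ /= -!/(bact _ _ _) Qdiff_genS !bactD bact_sgn.
by rewrite !bactD !bactA !mulr1 !mul1r.
Qed.

Lemma QdiffD n (q r : Q n.+1) : Qdiff (q + r) = Qdiff q + Qdiff r.
Proof. exact: linearD. Qed.

Lemma Qdiff_sgn n m (q : Q n.+1) : Qdiff (sgn m q) = sgn m (Qdiff q).
Proof. by rewrite /sgn; case: odd; rewrite ?linearN. Qed.

(** The words xx and yy vanish, xy and yx cancel each other, and a left and a
    right multiplication cancel thanks to the alternating sign. *)
Lemma Qdiff_Qdiff n (q : Q n.+2) : Qdiff (Qdiff q) = 0.
Proof.
move: q; apply: (Qmod_ext _ _ _ (fun=> 0)) => [q r|q r|w c i j].
- by rewrite (QdiffD _ q) QdiffD.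
- by rewrite addr0.
rewrite -genS_ord; move: (lam_word _) (nat_of_ord j) => a k {w j}.
rewrite Qdiff_bact !QdiffD Qdiff_sgn QdiffD.
case: k => [|k].
  rewrite genS0 !bactm0 !linear0 !Qdiff_bact !genS0 !bactm0.
  rewrite mulrA lam_yy mul0r bact0r -mulrA lam_yy mulr0 bact0l.
  by rewrite !sgnE !addr0 !add0r !subr0 addNr.
rewrite !Qdiff_bact !(mulrA _ _ c) -!(mulrA a) lam_xx lam_yy lam_yx.
rewrite !mul0r !mulr0 !bact0l !bact0r mulNr mulrN bactNl bactNr !sgnE oppr0 !add0r !addr0.
(* The twelve remaining terms cancel in pairs. *)
rewrite (AC ((1*2)*(1*2)*(3*3)) ((1*4)*(2*7)*(3*10)*(5*8)*(6*11)*(9*12))) /=.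
by rewrite !addNr addrN !addr0.
Qed.

(** * The contracting homotopy *)

Section Transport.
Context {n : nat} (phi : {linear Lambda -> Lambda}) {M : lmodType Ec}.
Variable T : 'I_s * 'I_n.+1 -> M.

Definition left_map : E -> E := tensor_lift (fun a c : Lambda => phi a ⊗ c).

Lemma left_map_bilin : bilin (fun a c : Lambda => phi a ⊗ c).
Proof.
split=> [c k a a'|a k c d]; first by rewrite linearP tensDl tensZl.
by rewrite tensDr tensZr.
Qed.

(** The map a b_p c |-> phi(a) T_p c.  It is linear for the right action only,
    as phi need not be Lambda-linear. *)
Definition transport (q : Q n) : M := \sum_p (left_map (Qcoef q p) : Ec) *: T p.

Lemma transportD q r : transport (q + r) = transport q + transport r.
Proof.
rewrite /transport -big_split; apply: eq_bigr => p _ /=.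
rewrite -scalerDl; congr (_ *: _).
rewrite -[q]scale1r Qcoef_linear scale1r.
by rewrite [_ * _](mulr1 (Qcoef q p)) /left_map (tensor_liftD left_map_bilin).
Qed.

Lemma transport_gen a c i (j : 'I_n.+1) :
  transport (bact a c (Qgen K i j)) =
  bact (phi (a * e i)) (e (shift n i) * c) (T (i, j)).
Proof.
have H p : Qcoef (bact a c (Qgen K i j)) p =
    if p == (i, j) then (a * e i) ⊗ (e (shift n i) * c) else 0.
  rewrite -[bact _ _ _]addr0 Qcoef_linear Qcoef_gen [Qcoef 0 p]/Qcoef /= ffunE addr0.
  by case: eqP => _; rewrite ?mul0r // envE.
rewrite /transport (bigD1 (i, j)) //= big1 => [|p pN]; rewrite H.
  by rewrite eqxx addr0 /left_map (tensor_liftE left_map_bilin).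
by rewrite (negPf pN) /left_map (tensor_lift0 left_map_bilin) scale0r.
Qed.

End Transport.

(** Deletes a last letter x, and kills the basis elements that cannot be written
    with one; the sign comes from xy = - yx. *)
Definition strip_x : {linear Lambda -> Lambda} :=
  lam_lift (fun=> 0) e (fun=> 0) (fun i => - (e i * y)).
Definition coef_y : {linear Lambda -> Lambda} :=
  lam_lift (fun=> 0) (fun=> 0) e (fun=> 0).
Definition coef_xy : {linear Lambda -> Lambda} :=
  lam_lift (fun=> 0) (fun=> 0) (fun=> 0) e.

(** The letter x that is stripped joins the generator, so the index j grows by
    one.  The last two parts live on b_{i,0}, where the x-component of the
    generator is trivial and the homotopy in the variable y takes over.  The
    constant is sealed, lest unification unfold it into a sum. *)
Definition homotopy n : Q n -> Q n.+1 := locked_with lock_key (fun q =>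
  transport strip_x (fun p => sgn n.+1 (b n.+1 (ord_pred p.1) p.2.+2)) q +
  transport coef_y (fun p => if p.2 == 0 :> nat then
     sgn n.+1 (b n.+1 (ord_pred p.1) 1) else 0) q +
  transport coef_xy (fun p => if p.2 == 0 :> nat then
     bact 1 x (b n.+1 (ord_pred (ord_pred p.1)) 1) else 0) q).

Lemma homotopyD n (q r : Q n) :
  homotopy n (q + r) = homotopy n q + homotopy n r.
Proof.
by rewrite /homotopy !locked_withE !transportD (AC (2*2*2) ((1*3*5)*(2*4*6))).
Qed.

Lemma homotopy0 n : homotopy n 0 = 0.
Proof. by apply: (addrI (homotopy n 0)); rewrite -homotopyD !addr0. Qed.

Lemma homotopyN n (q : Q n) : homotopy n (- q) = - homotopy n q.
Proof. by apply/eqP; rewrite -addr_eq0 -homotopyD addNr homotopy0. Qed.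

Lemma homotopy_sgn n m (q : Q n) : homotopy n (sgn m q) = sgn m (homotopy n q).
Proof. by rewrite /sgn; case: odd; rewrite ?homotopyN. Qed.

(** The four lemmas after this one are its instances, one for each word of the
    basis. *)
Lemma homotopy_word n w c i k :
  let i' := shift (size w) i in
  let d := e (shift n i') * c in
  homotopy n (bact (lam_word w) c (b n i' k.+1)) =
  bact (word_val (fun=> 0) e (fun=> 0) (fun i => - (e i * y)) i w) d
     (sgn n.+1 (b n.+1 (ord_pred i') k.+2)) +
  bact (word_val (fun=> 0) (fun=> 0) e (fun=> 0) i w) d
     (if k == 0 then sgn n.+1 (b n.+1 (ord_pred i') 1) else 0) +
  bact (word_val (fun=> 0) (fun=> 0) (fun=> 0) e i w) d
     (if k == 0 then bact 1 x (b n.+1 (ord_pred (ord_pred i')) 1) else 0).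
Proof.
move=> i' d; have [kn|nk] := ltnP k n.+1; last first.
  rewrite (genS_out n _ k.+1) // (genS_out n.+1 _ k.+2) //.
  by case: k nk => // k _; rewrite sgn0 !bactm0 homotopy0 !addr0.
rewrite (genS_ord _ i' (Ordinal kn)) /homotopy locked_withE !transport_gen /=.
by rewrite !lam_lift_word.
Qed.

Lemma homotopy1 n c i k : homotopy n (bact 1 c (b n i k)) = 0.
Proof.
case: k => [|k]; first by rewrite genS0 bactm0 homotopy0.
have := homotopy_word n [::] c i k; rewrite /= lam_word0 => ->.
by rewrite !bact0l !addr0.
Qed.

Lemma homotopy_x n c i k :
  homotopy n (bact x c (b n (ordS i) k.+1)) = sgn n.+1 (bact 1 c (b n.+1 i k.+2)).
Proof.
have := homotopy_word n [:: false] c i k; rewrite /= lam_word1 => ->.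
by rewrite !bact0l !addr0 ordSK shiftS bact_sgn -(genS_fix n.+1 i k.+2 1 c) mul1r.
Qed.

Lemma homotopy_y n c i k :
  homotopy n (bact y c (b n (ordS i) k.+1)) =
  if k == 0 then sgn n.+1 (bact 1 c (b n.+1 i 1)) else 0.
Proof.
have := homotopy_word n [:: true] c i k; rewrite /= lam_word1 => ->.
rewrite !bact0l !addr0 add0r ordSK shiftS; case: ifP => _; last exact: bactm0.
by rewrite bact_sgn -(genS_fix n.+1 i 1 1 c) mul1r.
Qed.

Lemma homotopy_xy n c i k :
  homotopy n (bact (x * y) c (b n (ordS (ordS i)) k.+1)) =
  sgn n (bact y c (b n.+1 (ordS i) k.+2)) +
  if k == 0 then bact 1 (x * c) (b n.+1 i 1) else 0.
Proof.
have := homotopy_word n [:: false; true] c i k.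
rewrite /= lam_word_cons lam_word1 => ->; rewrite !bact0l !addr0 !ordSK shiftS.
congr (_ + _).
  rewrite lam_e_y -(genS_fix n.+1 (ordS i) k.+2 y c).
  by rewrite bactNl bact_sgn sgnS opprK.
case: ifP => _; last exact: bactm0.
rewrite bactA mulr1 -(genS_fix n.+1 i 1 1 (x * c)) mul1r; congr bact.
by rewrite !mulrA lam_e_x shiftS.
Qed.

Local Notation homotopyE := (homotopy_x, homotopy_y, homotopy_xy, homotopy_sgn,
  homotopyD, homotopyN, homotopy1).

(** * The homotopy identity in positive degrees *)

(** The next four lemmas treat the words of the basis.  The sources i + 1 and
    i + 2 of the generators leave room for the letters on their left.  The case
    distinctions on k, the second index of the generator, isolate the terms
    b_{i,0} of the homotopy, which arise from b_{i,0} and b_{i,1}. *)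

Section HomotopyIdentity.
Variables (n : nat) (c : Lambda) (i : 'I_s) (k : nat).

Lemma homotopy_id_1 : let q := bact 1 c (b n.+1 i k.+1) in
  Qdiff (homotopy n.+1 q) + homotopy n (Qdiff q) = q.
Proof.
rewrite /= homotopy1 linear0 add0r Qdiff_bact !mul1r !homotopyE !add0r.
case: k => [|j]; rewrite ?homotopy_x /=.
  by rewrite genS0 bactm0 homotopy0 addr0 sgnK.
by rewrite add0r sgnK.
Qed.

Lemma homotopy_id_x : let q := bact x c (b n.+1 (ordS i) k.+1) in
  Qdiff (homotopy n.+1 q) + homotopy n (Qdiff q) = q.
Proof.
rewrite /= Qdiff_bact lam_xx bact0l addr0 !homotopyE Qdiff_sgn Qdiff_bact !mul1r !sgnE.
case: k => [|j]; rewrite ?homotopy_x /=.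
  rewrite genS0 bactm0 homotopy0 add0r.
  by rewrite (AC ((2*2)*(1*2)) ((1*7)*(2*5)*(3*6)*4)) /= !addrN !add0r.
rewrite !sgnE subr0.
by rewrite (AC ((2*2)*(2*1)) ((1*5)*(2*6)*(3*7)*4)) /= !addrN !add0r.
Qed.

Lemma homotopy_id_y : let q := bact y c (b n.+1 (ordS i) k.+1) in
  Qdiff (homotopy n.+1 q) + homotopy n (Qdiff q) = q.
Proof.
rewrite /= Qdiff_bact lam_yy bact0l add0r !homotopyE lam_yx bactNl !homotopyE.
case: k => [|[|j]];
  rewrite ?homotopy_y ?homotopy_xy ?genS0 ?bactm0 ?homotopy0 /= ?linear0.
- rewrite Qdiff_sgn Qdiff_bact !mul1r !genS0 !bactm0 !sgnE oppr0 !addr0 !add0r.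
  by rewrite addrC addKr.
- by rewrite !sgnE !addr0 !add0r addrC addrK.
by rewrite !sgnE !addr0 !add0r.
Qed.

Lemma homotopy_id_xy : let q := bact (x * y) c (b n.+1 (ordS (ordS i)) k.+1) in
  Qdiff (homotopy n.+1 q) + homotopy n (Qdiff q) = q.
Proof.
rewrite /= Qdiff_bact -!mulrA lam_yy lam_yx !mulrN mulrA lam_xx mul0r mulr0 oppr0.
rewrite !bact0l addr0 sgn0 addr0 !homotopyE !linearD /= Qdiff_sgn Qdiff_bact.
rewrite lam_yy bact0l lam_yx bactNl.
case: k => [|[|j]];
  rewrite ?homotopy_xy ?genS0 ?bactm0 ?homotopy0 /= ?linear0 ?Qdiff_bact.
- rewrite !mul1r !genS0 !bactm0 !sgnE oppr0 !addr0 !add0r.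
  rewrite (mulrA y) lam_yx mulNr bactNr -mulrA.
  by rewrite (AC ((2*1)*2*2) ((1*5)*(2*6)*(4*7)*3)) /= !addNr !add0r.
- rewrite !sgnE oppr0 add0r !addr0 (mulrA x) lam_xx mul0r bact0r addr0.
  by rewrite (AC ((2*1)*2) ((1*4)*(2*5)*3)) /= !addNr !add0r.
rewrite !sgnE oppr0 add0r !addr0.
by rewrite (AC ((2*1)*2) ((1*4)*(2*5)*3)) /= !addNr !add0r.
Qed.

End HomotopyIdentity.

Lemma homotopy_id n (q : Q n.+1) :
  Qdiff (homotopy n.+1 q) + homotopy n (Qdiff q) = q.
Proof.
move: q; apply: Qmod_ext => // [q r|w c i j].
  by rewrite homotopyD (QdiffD _ q) (QdiffD _ (homotopy _ q)) homotopyD; exact: addrACA.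
rewrite -(ord_predK i) -(ord_predK (ord_pred i)) -genS_ord.
have zero : Qdiff (homotopy n.+1 0) + homotopy n (Qdiff 0) = 0.
  by rewrite linear0 !homotopy0 linear0 addr0.
case: w => [|l [|l' [|l'' w]]]; last first.
- by rewrite (lam_word_long (l :: l' :: l'' :: w) isT) bact0l.
- rewrite lam_word_cons lam_word1; case: l l' => -[] /=.
  + by rewrite lam_yy bact0l.
  + by rewrite lam_yx bactNl homotopyN !linearN /= homotopyN -opprD homotopy_id_xy.
  + exact: homotopy_id_xy.
  by rewrite lam_xx bact0l.
- by rewrite lam_word1; case: l; [exact: homotopy_id_y | exact: homotopy_id_x].
by rewrite lam_word0; exact: homotopy_id_1.
Qed.

(** * The augmentation and the homotopy identity in degree 0 *)

Definition aug_section (a : Lambda) : Q 0 := \sum_i bact 1 a (b 0 i 1).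

Lemma aug_sectionD a a' : aug_section (a + a') = aug_section a + aug_section a'.
Proof. by rewrite /aug_section -big_split; apply: eq_bigr => i _; exact: bactDr. Qed.

Lemma aug_section0 : aug_section 0 = 0.
Proof. by apply: (addrI (aug_section 0)); rewrite -aug_sectionD !addr0. Qed.

Lemma aug_sectionN a : aug_section (- a) = - aug_section a.
Proof. by apply/eqP; rewrite -addr_eq0 -aug_sectionD addNr aug_section0. Qed.

Lemma aug_section_e i a : aug_section (e i * a) = bact 1 a (b 0 i 1).
Proof.
rewrite /aug_section (bigD1 i) //= big1 => [|k ki].
  by rewrite -genS_fix mulrA lam_e_idem genS_fix addr0.
by rewrite -genS_fix mulrA lam_e_mul (negPf ki) mul0r bact0r.
Qed.

Lemma Qaug_bact a c i : Qaug (bact a c (b 0 i 1)) = a * e i * c.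
Proof. by rewrite /bact linearZ /= /genS /= Qaug_gen; exact: regular_actE. Qed.

Lemma QaugD (q r : Q 0) : Qaug (q + r) = (Qaug q : Lambda) + (Qaug r : Lambda).
Proof. exact: linearD. Qed.

Lemma QaugN (q : Q 0) : Qaug (- q) = - (Qaug q : Lambda).
Proof. exact: linearN. Qed.

Lemma Qaug_section a : Qaug (aug_section a) = a.
Proof.
rewrite /aug_section linear_sum /=.
under eq_bigr => i _ do rewrite Qaug_bact mul1r.
by rewrite -[RHS]mul1r -lam_e_sum mulr_suml.
Qed.

Lemma Qaug_Qdiff (q : Q 1) : Qaug (Qdiff q) = 0.
Proof.
move: q; apply: (Qmod_ext _ _ _ (fun=> 0)) => [q r|q r|w c i j].
- by rewrite (QdiffD _ q) QaugD.
- by rewrite addr0.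
rewrite -genS_ord; move: (lam_word _) (nat_of_ord j) (ltn_ord j) => a k {w j}.
rewrite Qdiff_bact /sgn /=.
case: k => [|[]] // _; rewrite ?genS0 ?(genS_out 0 _ 2) // !bactm0 ?add0r ?addr0 QaugD.
  by rewrite QaugN !Qaug_bact -(mulrA a y) -lam_e_y -!mulrA addrN.
by rewrite QaugN !Qaug_bact -(mulrA a x) -lam_e_x -!mulrA addrN.
Qed.

Lemma homotopy_id0 (q : Q 0) : Qdiff (homotopy 0 q) + aug_section (Qaug q) = q.
Proof.
move: q; apply: Qmod_ext => // [q r|w c i j].
  by rewrite homotopyD (QdiffD _ (homotopy _ q)) QaugD aug_sectionD; exact: addrACA.
rewrite -(ord_predK i) -(ord_predK (ord_pred i)) -genS_ord (ord1 j) Qaug_bact.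
set i' := ord_pred (ord_pred i).
have zero d : Qdiff (homotopy 0 0) + aug_section (0 * d) = 0.
  by rewrite homotopy0 linear0 mul0r aug_section0 addr0.
have id_xy : Qdiff (homotopy 0 (bact (x * y) c (b 0 (ordS (ordS i')) 1))) +
    aug_section (x * y * e (ordS (ordS i')) * c) =
    bact (x * y) c (b 0 (ordS (ordS i')) 1).
  rewrite homotopy_xy QdiffD Qdiff_sgn !Qdiff_bact !mul1r -mulrA lam_yy lam_yx.
  rewrite genS0 !bactm0 (mulrA y) lam_yx mulNr !bactNl !bactNr !addr0 !add0r /sgn /= opprK.
  have -> : x * y * (e (ordS (ordS i')) * c) = e i' * (x * y * c).
    by rewrite !mulrA lam_e_x -(mulrA x (e _)) lam_e_y !mulrA.
  by rewrite aug_section_e (AC (2*2*1) ((1*4)*(5*3)*2)) /= !addrN !add0r.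
case: w => [|l [|l' [|l'' w]]]; last first.
- by rewrite (lam_word_long (l :: l' :: l'' :: w) isT) bact0l mul0r.
- rewrite lam_word_cons lam_word1; case: l l' => -[] /=.
  + by rewrite lam_yy bact0l mul0r.
  + by rewrite lam_yx bactNl homotopyN !linearN /= !mulNr aug_sectionN -opprD id_xy.
  + exact: id_xy.
  by rewrite lam_xx bact0l mul0r.
- rewrite lam_word1; case: l => /=.
    rewrite homotopy_y Qdiff_sgn Qdiff_bact !mul1r genS0 genS0 !bactm0.
    rewrite -lam_e_y -mulrA aug_section_e.
    by rewrite !add0r !addr0 /sgn /= opprD opprK addrAC addNr add0r.
  rewrite homotopy_x Qdiff_sgn Qdiff_bact !mul1r !(genS_out 0 _ 2) // !bactm0.
  rewrite -lam_e_x -mulrA aug_section_e.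
  by rewrite !add0r !addr0 /sgn /= opprD opprK addrAC addNr add0r.
by rewrite lam_word0 mul1r homotopy1 linear0 add0r aug_section_e.
Qed.

(** * Projectivity and minimality *)

(** A lifting of the images of the generators extends by Qext, which is linear
    for every choice of values. *)
Lemma Qmod_projective n : projective (Q n).
Proof.
move=> M N g f gsurj.
have [m mE] := choice (fun p => gsurj (f (Qgen K p.1 p.2))).
pose hL := GRing.isLinear.Build Ec (Q n) M _ (Qext m) (Qext_linear m).
pose h : {linear Q n -> M} := HB.pack (Qext m) hL.
exists h => q; rewrite -[h q]/(Qext m q) [in RHS](Qgen_span q) /Qext !linear_sum.
by apply: eq_bigr => p _; rewrite !linearZ mE.
Qed.

(** Write b = u + l with u in the image of the differential and l in L.  If w and
    w' have d letters in all, then w l w' is in L, and w u w' is a sum of terms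
    with more than d letters; and there are no nonzero terms with 5 letters. *)
Lemma Qdiff_image_superfluous n (U : Q n -> Prop) :
  (forall u, U u -> exists q, Qdiff q = u) -> superfluous U.
Proof.
move=> UQ L [L0 LZD] LU.
have LZ t m : m \in L -> t *: m \in L.
  by move=> mL; rewrite -[_ *: _]addr0; apply: LZD.
have LD m m' : m \in L -> m' \in L -> m + m' \in L.
  by move=> mL m'L; rewrite -[m]scale1r; apply: LZD.
have Lsgn p m : m \in L -> sgn p m \in L by rewrite -scale_sgn; exact: LZ.
have Lscal k a c m : bact a c m \in L -> bact (k *: a) c m \in L.
  rewrite -[k *: a]mul1r -bqa_scalerAr bqa_scalerAl -[c]mulr1 -bactA mulr1.
  exact: LZ.
have H d : forall w w' : seq bool, (5 <= d + (size w + size w'))%N ->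
   forall i (j : 'I_n.+1), bact (lam_word w) (lam_word w') (Qgen K i j) \in L.
  elim: d => [|d IH] w w' dw i j.
    have [ww|ww] := ltnP 2 (size w); first by rewrite lam_word_long // bact0l.
    rewrite (lam_word_long w') ?bact0r //.
    by rewrite ltnNge; apply/negP => /(leq_add ww); rewrite leqNgt dw.
  have IHg v v' k p t : (5 <= d + (size v + size v'))%N ->
      bact (t *: lam_word v) (lam_word v') (b n p k) \in L.
    move=> dv; apply: Lscal.
    by rewrite /genS; case: ifP => _; [exact: IH | rewrite bactm0].
  have [u [l [/UQ [q <-] lL ->]]] := LU (Qgen K i j).
  rewrite bactD; apply: (LD _ _); last exact: LZ.
  elim/Qmod_word_ind: q => [|q r Hq Hr|t v v' p k].
  - by rewrite linear0 bactm0.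
  - by rewrite QdiffD bactD; exact: LD.
  have Hr c p' k' : bact (lam_word w) (lam_word w')
      (bact (t *: lam_word v) (lam_letter c * lam_word v') (b n p' k')) \in L.
    rewrite bactA -bqa_scalerAr -mulrA -!lam_word_cat -lam_word_cons; apply: IHg.
    by rewrite /= !size_cat; lia.
  have Hl c p' k' : bact (lam_word w) (lam_word w')
      (bact (t *: lam_word v * lam_letter c) (lam_word v') (b n p' k')) \in L.
    rewrite -lam_word1 bactA -bqa_scalerAl -bqa_scalerAr -!lam_word_cat; apply: IHg.
    by rewrite /= !size_cat /=; lia.
  rewrite -genS_ord Qdiff_bact bactD bact_sgn !bactD.
  apply: (LD _ _); last apply: (Lsgn _ _); apply: (LD _ _).
  - exact: (Hr false).
  - exact: (Hr true).
  - exact: (Hl true).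
  exact: (Hl false).
move=> q; elim/Qmod_word_ind: q => [|q r|t w w' i j] //; first exact: LD.
by apply: Lscal; exact: (H 5%N).
Qed.

End Resolution.

Theorem theorem2p6 (K : closedFieldType) (s : nat) (s_ge1 : (1 <= s)%N) :
  @minimal_projective_resolution (envc (Lambda_rel K s))
    (regular_bimodule (Lambda_rel K s)) (fun n => Qmod K s n)
    (fun n => @Qdiff K s n) (@Qaug K s).
Proof.
have ex0 (q : Qmod K s 0) : Qaug q = 0 <-> exists r, Qdiff r = q.
  split=> [q0|[r <-]]; last exact: Qaug_Qdiff.
  by exists (homotopy 0 q); rewrite -[RHS]homotopy_id0 q0 aug_section0 addr0.
have ex n (q : Qmod K s n.+1) : Qdiff q = 0 <-> exists r, Qdiff r = q.
  split=> [q0|[r <-]]; last exact: Qdiff_Qdiff.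
  by exists (homotopy n.+1 q); rewrite -[RHS]homotopy_id q0 homotopy0 addr0.
split=> //.
- exact: Qmod_projective.
- by move=> a; exists (aug_section a); exact: Qaug_section.
- by apply: Qdiff_image_superfluous => u /ex0.
by move=> n; apply: Qdiff_image_superfluous => u /ex.
Qed.
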